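(* For each $s\in\mathbb N$ and each sequence $\bar\epsilon=\{\epsilon_n\}_{n=1}^{\infty}$ of nonnegative numbers tending to $0$, there exist a set $Y_{s}$ (the $2\pi$-periodic extension of $2s$ distinct points of $[-\pi,\pi)$) and a function $f=f_{\bar\epsilon}\in\Delta^{(1)}(Y_{s})$ such that $$\limsup_{n\rightarrow\infty}\frac{E_n^{(1)}(f,\epsilon_n,Y_{s})}{\omega_4(f,\pi/n)}=\infty.$$
   Context: $\mathbb T_n$ is the space of real trigonometric polynomials $a_0+\sum_{j=1}^n(a_j\cos jx+b_j\sin jx)$ of degree $\le n$. $\|f\|=\max_{x\in\mathbb R}|f(x)|$ for continuous $2\pi$-periodic $f:\mathbb R\to\mathbb R$. The 4th modulus of smoothness is $\omega_4(f,t)=\sup_{0<h\le t}\sup_{x\in[-\pi,\pi]}|\Delta_h^4f(x)|$, where $\Delta_h^4 f(x)=\sum_{i=0}^4(-1)^{4-i}\binom4i f(x-2h+ih)$. A set $Y_s$: fix $2s$ points $-\pi\le y_{2s}<y_{2s-1}<\dots<y_1<\pi$ and define $y_i$ for all other $i\in\mathbb Z$ by $y_i=y_{i+2s}+2\pi$ (so $y_0=y_{2s}+2\pi$); $Y_s=\{y_i\}_{i\in\mathbb Z}$. $\Delta^{(1)}(Y_s)$ is the set of all continuous $2\pi$-periodic functions $f:\mathbb R\to\mathbb R$ that are nondecreasing on $[y_1,y_0]$, nonincreasing on $[y_2,y_1]$, nondecreasing on $[y_3,y_2]$, and so on alternately. Put $\Pi(x,Y_s)=\prod_{i=1}^{2s}\sin\frac12(x-y_i)$.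 For $\epsilon\ge0$ and $f\in\Delta^{(1)}(Y_s)$, $E_n^{(1)}(f,\epsilon,Y_s)=\inf_{P_n}\|f-P_n\|$, where the infimum is over all $P_n\in\mathbb T_n$ such that the Lebesgue measure of $\{x\in[-\pi,\pi]:P_n'(x)\Pi(x,Y_s)\ge0\}$ is at least $2\pi-\epsilon$. *)

(* Defs.v *)
From HB Require Import structures.
From mathcomp Require Import all_boot all_order all_algebra.
From mathcomp Require Import all_classical all_reals all_analysis.
Set Implicit Arguments.
Unset Strict Implicit.
Unset Printing Implicit Defensive.
Import Order.TTheory GRing.Theory Num.Theory.
Import numFieldNormedType.Exports.
Local Open Scope classical_set_scope.
Local Open Scope ring_scope.

Definition trig_poly (R : realType) (n : nat) : set (R -> R) :=
  [set P | exists (a0 : R) (a b : nat -> R), forall x,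
    P x = a0 + \sum_(1 <= j < n.+1)
                 (a j * cos (j%:R * x) + b j * sin (j%:R * x))].

(* Used only for continuous 2pi-periodic f, where the set below is bounded and
   its supremum is attained, so that this is the maximum of |f|. *)
Definition sup_norm (R : realType) (f : R -> R) : R :=
  sup [set `|f x| | x in [set: R]].

Definition diff4 (R : realType) (h : R) (f : R -> R) (x : R) : R :=
  \sum_(0 <= i < 5) (-1) ^+ (4 - i) * 'C(4, i)%:R * f (x - 2 * h + i%:R * h).

(* Both suprema are over bounded sets when f is continuous and 2pi-periodic.
   For such f and t > 0, omega4 f t = 0 only if f is constant. *)
Definition omega4 (R : realType) (f : R -> R) (t : R) : R :=
  sup [set sup [set `|diff4 h f x| | x in `[- pi, pi]] | h in `]0, t]].

(* The whole family (y_i), i in Z. The last clause is both the definition of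
   y_i outside 1 <= i <= 2s and a property of all the y_i. *)
Definition is_Ys (R : realType) (s : nat) (y : int -> R) : Prop :=
  [/\ - pi <= y (2 * s)%:Z,
      forall i : int, 1 <= i -> i < (2 * s)%:Z -> y (i + 1) < y i,
      y 1 < pi &
      forall i : int, y i = y (i + (2 * s)%:Z) + 2 * pi].

Definition Delta1 (R : realType) (y : int -> R) : set (R -> R) :=
  [set f | [/\ continuous f,
      forall x, f (x + 2 * pi) = f x,
      forall k : int,
        {in `[y (2 * k + 1), y (2 * k)] &, {homo f : u v / u <= v}} &
      forall k : int,
        {in `[y (2 * k + 2), y (2 * k + 1)] &, {homo f : u v /~ u <= v}}]].

Definition PiY (R : realType) (s : nat) (y : int -> R) (x : R) : R :=
  \prod_(1 <= i < (2 * s).+1) sin ((x - y i%:Z) / 2).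

Definition almost_comonotone (R : realType) (s : nat) (y : int -> R)
    (eps : R) : set (R -> R) :=
  [set P : R -> R |
    let A := [set x : R | x \in `[- pi, pi] /\ 0 <= derive1 P x * PiY s y x] in
    ((2 * pi - eps)%R%:E <= lebesgue_measure A)%E].

(* The infimum is over a nonempty set (for eps >= 0 constants are admissible)
   of nonnegative numbers. *)
Definition E1 (R : realType) (s : nat) (y : int -> R) (n : nat)
    (f : R -> R) (eps : R) : R :=
  inf [set sup_norm (f \- P) | P in trig_poly n `&` almost_comonotone s y eps].

(* Main.v *)
Require Import Defs.
From HB Require Import structures.
From mathcomp Require Import all_boot all_order all_algebra.
From mathcomp Require Import all_classical all_reals all_analysis.
From mathcomp Require Import ring lra zify.
Import Order.TTheory GRing.Theory Num.Theory.
Import numFieldNormedType.Exports.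
Local Open Scope classical_set_scope.
Local Open Scope ring_scope.

(* Place the nodes equidistantly and put t = x - x_0, where x_0 is the midpoint of
   [y_1, y_0]: f must have derivative of the sign of cos(st), and Pi(x, Y_s) > 0
   for small t. The function is f = sum_k alpha_k g_k(x - x_0), where g_k is a
   trigonometric polynomial of high degree whose derivative
     g'(t) = cos(st) (1 - cos(mt) - eta + eta w(mt)),  w(t) = ((1 + cos t)/2)^L,
   eta = 2/L, has the sign of cos(st) by Bernoulli's inequality. Replacing the
   narrow bump w by its mean mu, which is small, gives a polynomial T of degree
   m + s that is very close to g but has T' < -eta/4 near the points
   2 pi k/m close to 0. If P is of degree n = l^3 m and comonotone up to a set of
   small measure, then P' >= 0 at some such point, so that the derivative of
   P - F - alpha T is of order alpha eta there, F being the sum of the previous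
   terms. By Bernstein's inequality P is at distance at least c alpha eta/n from
   F + alpha T, while omega_4 at pi/n is at most C alpha eta/(l n). All g_k have
   derivatives O(t^4) at 0, so that F' is negligible at the points used, and
   the later terms are negligible because the alpha_k decrease fast. *)

(** * Consequences of the mean value theorem *)

Lemma is_derive1_mvt (R : realType) (f df : R -> R) (a b : R) :
  (forall x : R, is_derive x 1 f (df x)) -> a <= b ->
  exists2 c, a <= c <= b & f b - f a = df c * (b - a).
Proof.
move=> fdf ab; have [|c cab E] := MVT_segment ab (fun x _ => fdf x).
  apply: continuous_subspaceT => x; apply: differentiable_continuous.
  by apply/derivable1_diffP; have := fdf x; case.
by exists c => //; move: cab; rewrite in_itv.
Qed.

Lemma is_derive1_homo (R : realType) (f df : R -> R) (a b : R) :
  (forall x : R, is_derive x 1 f (df x)) -> a <= b ->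
  (forall x, a <= x <= b -> 0 <= df x) -> f a <= f b.
Proof.
move=> fdf ab df0; have [c cab E] := is_derive1_mvt _ _ _ _ _ fdf ab.
by rewrite -subr_ge0 E mulr_ge0 ?subr_ge0 ?df0.
Qed.

Lemma is_derive1_lipschitz (R : realType) (f df : R -> R) (K : R) :
  (forall x : R, is_derive x 1 f (df x)) -> (forall x, `|df x| <= K) ->
  forall a b, `|f b - f a| <= K * `|b - a|.
Proof.
move=> fdf dfK.
have H a b : a <= b -> `|f b - f a| <= K * `|b - a|.
  move=> ab; have [c cab ->] := is_derive1_mvt _ _ _ _ _ fdf ab.
  by rewrite normrM ler_wpM2r.
move=> a b; have [/H//|/ltW /H] := leP a b.
by rewrite distrC [`|_ - b|]distrC.
Qed.

Lemma is_derive1_cos_affine (R : realType) (c a p x : R) :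
  is_derive x 1 (fun x => c * cos (a * x + p)) (- c * a * sin (a * x + p)).
Proof.
have H : is_derive x 1 (( *:%R a) + cst p : R -> R) a.
  by apply: is_derive_eq; rewrite addr0 /GRing.scale /= mulr1.
have -> : (fun x => c * cos (a * x + p)) = c *: (cos \o (( *:%R a) + cst p : R -> R)) by [].
apply: is_derive_eq; rewrite /GRing.scale /= /GRing.scale /=; ring.
Qed.

(* [tp n f f'] : [f] is a trigonometric polynomial of degree at most [n] with
   derivative [f'], written in the translation invariant amplitude-phase form. *)
Inductive tp (R : realType) (n : nat) : (R -> R) -> (R -> R) -> Prop :=
| tp0 : tp R n (fun=> 0) (fun=> 0)
| tpS (f f' : R -> R) (c : R) (j : nat) (p : R) : (j <= n)%N -> tp R n f f' ->
    tp R n (fun x => f x + c * cos (j%:R * x + p))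
           (fun x => f' x - c * j%:R * sin (j%:R * x + p)).
Arguments tp {R} n f f'.

(** * Trigonometric polynomials and Bernstein's inequality *)

Section trigonometric_polynomials.
Context {R : realType}.
Implicit Types (n : nat) (f g : R -> R).

Lemma tp_ext n f f' g g' : f =1 g -> f' =1 g' -> tp n f f' -> tp n g g'.
Proof. by move=> /funext -> /funext ->. Qed.

Lemma tp1 n (c p : R) (j : nat) : (j <= n)%N ->
  tp n (fun x => c * cos (j%:R * x + p)) (fun x => - (c * j%:R * sin (j%:R * x + p))).
Proof.
move=> jn; apply: tp_ext (tpS _ _ _ _ c j p jn (tp0 _ _)) => x /=; by rewrite add0r.
Qed.

Lemma tp_cst n (c : R) : tp n (fun=> c) (fun=> 0).
Proof.
apply: tp_ext (tp1 n c 0 0 _) => // x; first by rewrite mul0r addr0 cos0 mulr1.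
by rewrite mulr0 mul0r oppr0.
Qed.

Lemma tpD n f f' g g' : tp n f f' -> tp n g g' ->
  tp n (fun x => f x + g x) (fun x => f' x + g' x).
Proof.
move=> tf; elim=> [|h h' c j p jn _ IH].
  by apply: tp_ext tf => x; rewrite addr0.
by apply: tp_ext (tpS _ _ _ _ c j p jn IH) => x; rewrite addrA.
Qed.

Lemma tpZ n (a : R) f f' : tp n f f' -> tp n (fun x => a * f x) (fun x => a * f' x).
Proof.
elim=> [|h h' c j p jn _ IH].
  by apply: tp_ext (tp0 _ _) => x; rewrite mulr0.
by apply: tp_ext (tpS _ _ _ _ (a * c) j p jn IH) => x /=; ring.
Qed.

Lemma tpB n f f' g g' : tp n f f' -> tp n g g' ->
  tp n (fun x => f x - g x) (fun x => f' x - g' x).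
Proof.
move=> tf /(tpZ _ (-1)) tg.
by apply: tp_ext (tpD _ _ _ _ _ tf tg) => x; rewrite mulN1r.
Qed.

Lemma tp_le (m n : nat) f f' : (m <= n)%N -> tp m f f' -> tp n f f'.
Proof.
move=> mn; elim=> [|h h' c j p jm _ IH]; first exact: tp0.
exact: tpS (leq_trans jm mn) IH.
Qed.

Lemma tp_shift n (a : R) f f' : tp n f f' ->
  tp n (fun x => f (x + a)) (fun x => f' (x + a)).
Proof.
elim=> [|h h' c j p jn _ IH]; first exact: tp0.
apply: tp_ext (tpS _ _ _ _ c j (j%:R * a + p) jn IH) => x /=;
by rewrite mulrDr addrA.
Qed.

Lemma tp_derive n f f' (x : R) : tp n f f' -> is_derive x 1 f (f' x).
Proof.
elim=> [|h h' c j p _ _ IH]; first exact: is_derive_cst.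
have -> : (fun x => h x + c * cos (j%:R * x + p)) =
  h + (fun x => c * cos (j%:R * x + p)) by [].
have H := is_derive1_cos_affine R c j%:R p x.
by apply: is_derive_eq; rewrite !mulNr.
Qed.

Lemma cosD2pin (x : R) (n : nat) : cos (x + n%:R * (2 * pi)) = cos x.
Proof.
have -> : n%:R * (2 * pi) = (pi : R) *+ 2 *+ n by rewrite !mulr_natl.
exact: (periodicn (@cosD2pi R)).
Qed.

Lemma sinD2pin (x : R) (n : nat) : sin (x + n%:R * (2 * pi)) = sin x.
Proof.
have -> : n%:R * (2 * pi) = (pi : R) *+ 2 *+ n by rewrite !mulr_natl.
exact: (periodicn (@sinD2pi R)).
Qed.

Lemma tp_periodic n f f' (x : R) : tp n f f' -> f (x + 2 * pi) = f x.
Proof.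
elim=> [|h h' c j p _ _ IH] //=; rewrite IH.
by rewrite mulrDr addrAC cosD2pin.
Qed.

Lemma tp_bounded n f f' : tp n f f' -> exists M, forall x, `|f x| <= M.
Proof.
elim=> [|h h' c j p _ _ [M IH]]; first by exists 0 => x; rewrite normr0.
exists (M + `|c|) => x; apply: le_trans (ler_normD _ _) _.
by rewrite lerD // normrM ler_piMr // cos_max.
Qed.

Lemma trig_poly_tp n (P : R -> R) : trig_poly n P -> exists P', tp n P P'.
Proof.
move=> [a0 [a [b H]]].
have -> : P = fun x => a0 + \sum_(1 <= j < n.+1)
    (a j * cos (j%:R * x) + b j * sin (j%:R * x)) by apply/funext.
suff [g Hg] : exists g, tp n (fun x => \sum_(1 <= j < n.+1)
    (a j * cos (j%:R * x) + b j * sin (j%:R * x))) g.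
  by eexists; exact: tpD (tp_cst _ _) Hg.
(* The induction runs over the number of terms, while the degree bound stays [n]. A sine is entered
   as a cosine with phase -pi/2. *)
have : (n <= n)%N by [].
elim: {1 4}n => [|k IH] kn.
  by exists (fun=> 0); apply: tp_ext (tp0 _ _) => x //; rewrite big_geq.
have [g Hg] := IH (ltnW kn).
eexists; apply: tp_ext (tpD _ _ _ _ _ Hg (tpD _ _ _ _ _
  (tp1 n (a k.+1) 0 k.+1 kn) (tp1 n (b k.+1) (- (pi / 2)) k.+1 kn))) => x //.
by rewrite [RHS]big_nat_recr //= addr0 cosBpihalf.
Qed.

Definition dirichlet (r : nat) (t : R) : R :=
  1 + 2 * \sum_(d < r) cos (d.+1%:R * t).

(** The Fejer kernel without the usual factor 1/n, so its mean value is n. *)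
Definition fejer (n : nat) (t : R) : R := \sum_(r < n) dirichlet r t.

(** The right side is |S_n|^2 with S_n = sum_(l < n) e^(ilt). Passing to S_(n+1) adds 1 + 2
    Re(e^(-int) S_n), which is [dirichlet n t]. *)
Lemma fejerE n (t : R) : fejer n t =
  (\sum_(l < n) cos (l%:R * t)) ^+ 2 + (\sum_(l < n) sin (l%:R * t)) ^+ 2.
Proof.
elim: n => [|n IH]; first by rewrite /fejer !big_ord0 expr0n addr0.
rewrite /fejer !big_ord_recr /= -/(fejer n t) IH.
have E : \sum_(d < n) cos (d.+1%:R * t) =
   (\sum_(l < n) cos (l%:R * t)) * cos (n%:R * t) +
   (\sum_(l < n) sin (l%:R * t)) * sin (n%:R * t).
  rewrite !mulr_suml -big_split /= (reindex_inj rev_ord_inj) /=.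
  apply: eq_bigr => i _; rewrite -subSn // subSS natrB; last exact: ltnW.
  by rewrite mulrBl cosB; congr (_ + _); exact: mulrC.
rewrite /dirichlet E -[X in X + 2 * _](cos2Dsin2 (n%:R * t)); ring.
Qed.

Lemma fejer_ge0 n (t : R) : 0 <= fejer n t.
Proof. by rewrite fejerE addr_ge0 ?sqr_ge0. Qed.

Section nodes.
Variable N : nat.
Let node (k : nat) : R := k%:R * (2 * pi / N%:R).

(** Multiplication by 2 sin z, where 2z is the angle step, makes the sum telescope. For M = N the
    two ends cancel by periodicity, and sin z is not 0 since 0 < d < N. *)
Lemma cos_sum0 (d : nat) : (0 < d < N)%N ->
  \sum_(k < N) cos (d%:R * node k) = 0.
Proof.
move=> /andP[d0 dN].
have N0 : (0 : R) < N%:R by rewrite ltr0n; lia.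
pose z : R := d%:R * (pi / N%:R).
have sz : 0 < sin z.
  apply: sin_gt0_pi; rewrite mulr_gt0 ?ltr0n ?divr_gt0 ?pi_gt0 //= /z mulrA.
  by rewrite ltr_pdivrMr // mulrC ltr_pM2l ?pi_gt0 // ltr_nat.
have E M : 2 * sin z * \sum_(k < M) cos (d%:R * node k) =
    sin (d%:R * node M - z) + sin z.
  elim: M => [|M IH].
    by rewrite big_ord0 mulr0 /node mul0r mulr0 sub0r sinN addNr.
  rewrite big_ord_recr /= mulrDr IH.
  have -> : d%:R * node M.+1 - z = d%:R * node M + z.
    rewrite /node /z -natr1; by field; rewrite (gt_eqF N0).
  rewrite sinB sinD; ring.
have := E N; have -> : d%:R * node N - z = - z + d%:R * (2 * pi).
  rewrite /node /z; by field; rewrite (gt_eqF N0).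
rewrite sinD2pin sinN addNr => /eqP; rewrite !mulf_eq0 pnatr_eq0 /=.
by rewrite (gt_eqF sz) => /eqP.
Qed.

(** Discrete orthogonality: as a + r < N, none of the frequencies involved is a nonzero multiple of
    N, so only the term of frequency a in the kernel contributes. *)
Lemma cos_dirichlet_sum (a r : nat) : (a + r < N)%N ->
  \sum_(k < N) cos (a%:R * node k) * dirichlet r (node k) =
  if (a <= r)%N then N%:R else 0.
Proof.
elim: r => [|r IH] arN.
  under eq_bigr => k _ do rewrite /dirichlet big_ord0 mulr0 addr0 mulr1.
  have [->|a0] := posnP a; last first.
    rewrite cos_sum0; last by apply/andP; split; lia.
    by rewrite ifF //; lia.
  under eq_bigr => k _ do rewrite mul0r cos0.
  by rewrite sumr_const card_ord.
(* The difference frequency |a - (r+1)| is written with [maxn] and [minn] because subtraction on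
   naturals truncates. *)
have E k : cos (a%:R * node k) * dirichlet r.+1 (node k) =
   cos (a%:R * node k) * dirichlet r (node k)
   + (cos ((a + r.+1)%:R * node k) + cos (((maxn a r.+1) - minn a r.+1)%:R * node k)).
  rewrite /dirichlet big_ord_recr /= natrB; last by rewrite geq_min leq_maxl.
  have -> : cos (((maxn a r.+1)%:R - (minn a r.+1)%:R) * node k) =
     cos (a%:R * node k - r.+1%:R * node k).
    have [ar|ra] := leqP a r.+1; last by rewrite mulrBl.
    by rewrite -cosN -mulNr opprB mulrBl.
  have -> : (a + r.+1)%:R * node k = a%:R * node k + r.+1%:R * node k.
    by rewrite natrD mulrDl.
  rewrite cosB cosD; ring.
under eq_bigr => k _ do rewrite E.
rewrite !big_split /= IH; last lia.
rewrite cos_sum0 ?add0r; last by apply/andP; split; lia.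
have [ar1|] := eqVneq a r.+1.
  rewrite ar1 maxnn minnn subnn.
  under eq_bigr => k _ do rewrite mul0r cos0.
  by rewrite sumr_const card_ord leqnn ltnn add0r.
move=> ar; rewrite cos_sum0; last by apply/andP; split; lia.
by rewrite addr0; congr (if _ then _ else _); lia.
Qed.

(** The product of sines splits into frequencies n - j and n + j, tested against the Dirichlet
    kernels of order r < n. Frequency n + j exceeds every r and drops out; frequency n - j survives
    for exactly j values of r. The condition 3n < N excludes aliasing. *)
Lemma sin_fejer_sum n (j : nat) : (j <= n)%N -> (3 * n < N)%N ->
  \sum_(k < N) sin (j%:R * node k) * (sin (n%:R * node k) * fejer n (node k)) =
  N%:R * j%:R / 2.
Proof.
move=> jn nN.
have E k : sin (j%:R * node k) * (sin (n%:R * node k) * fejer n (node k)) =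
   \sum_(r < n) (cos ((n - j)%:R * node k) * dirichlet r (node k)
                 - cos ((n + j)%:R * node k) * dirichlet r (node k)) / 2.
  rewrite -mulr_suml sumrB -!mulr_sumr -/(fejer n (node k)).
  have -> : (n - j)%:R * node k = n%:R * node k - j%:R * node k.
    by rewrite natrB // mulrBl.
  have -> : (n + j)%:R * node k = n%:R * node k + j%:R * node k.
    by rewrite natrD mulrDl.
  by rewrite cosB cosD; field.
under eq_bigr => k _ do rewrite E.
rewrite exchange_big /=.
rewrite (eq_bigr (fun r : 'I_n => if (n - j <= r)%N then N%:R / 2 else 0 : R)); last first.
  move=> r _; have rn := ltn_ord r.
  rewrite -mulr_suml sumrB !cos_dirichlet_sum; [|lia..].
  by rewrite (_ : (n + j <= r)%N = false) ?subr0; [case: ifP => //; rewrite mul0r|lia].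
have C (c : R) m k : \sum_(r < k) (if (m <= r)%N then c else 0) = c * (k - m)%:R.
  elim: k => [|k IH]; first by rewrite big_ord0 sub0n mulr0.
  rewrite big_ord_recr /= IH; case: ifP => mk; last first.
    by rewrite addr0; congr (_ * _%:R); lia.
  by rewrite subSn // -natr1 mulrDr mulr1.
by rewrite C subKn //; field.
Qed.

End nodes.

(* Riesz-type interpolation: N f'(x) is the sum over N = 3n+1 equidistant nodes
   t of (f(x+t) - f(x-t)) sin(nt) F_n(t), and the Fejer kernel F_n is
   nonnegative with average n. *)
Lemma bernstein n f f' (M : R) : tp n f f' -> (forall x, `|f x| <= M) ->
  forall x, `|f' x| <= 2 * n%:R * M.
Proof.
move=> tf fM x.
pose N := (3 * n).+1; pose t k : R := k%:R * (2 * pi / N%:R).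
have N0 : (0 : R) < N%:R by rewrite ltr0n.
have E : \sum_(k < N) (f (x + t k) - f (x - t k)) *
   (sin (n%:R * t k) * fejer n (t k)) = N%:R * f' x.
  elim: tf => [|h h' c j p jn _ IH].
    by rewrite mulr0 big1 // => k _; rewrite subrr mul0r.
  have -> : N%:R * (h' x - c * j%:R * sin (j%:R * x + p)) =
    N%:R * h' x + (- 2 * c * sin (j%:R * x + p)) * (N%:R * j%:R / 2) by field.
  rewrite -IH -(sin_fejer_sum N n j jn (ltnSn _)) mulr_sumr -big_split /=.
  apply: eq_bigr => k _.
  have -> : j%:R * (x + t k) + p = (j%:R * x + p) + j%:R * t k by ring.
  have -> : j%:R * (x - t k) + p = (j%:R * x + p) - j%:R * t k by ring.
  rewrite cosB cosD /t; ring.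
rewrite -(ler_pM2l N0) -{1}(ger0_norm (ltW N0)) -normrM -E.
apply: le_trans (ler_norm_sum _ _ _) _.
have B k : `|(f (x + t k) - f (x - t k)) * (sin (n%:R * t k) * fejer n (t k))| <=
    2 * M * fejer n (t k).
  rewrite mulrA normrM (ger0_norm (fejer_ge0 _ _)) ler_wpM2r ?fejer_ge0 //.
  rewrite normrM; apply: le_trans (ler_piMr _ (sin_max _)) _ => //.
  apply: le_trans (ler_normB _ _) _.
  by have := fM (x + t k); have := fM (x - t k); lra.
apply: (@le_trans _ _ (\sum_(k < N) 2 * M * fejer n (t k))).
  by apply: ler_sum => k _; exact: B.
rewrite -mulr_sumr /fejer exchange_big /=.
(* Each Dirichlet kernel sums to N over the nodes, hence the Fejer kernel sums to N n. *)
rewrite (eq_bigr (fun=> N%:R)); last first.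
  move=> r _; have := cos_dirichlet_sum N 0 r.
  rewrite leq0n => <-; last by have := ltn_ord r; rewrite /N; lia.
  by apply: eq_bigr => k _; rewrite mul0r cos0 mul1r.
rewrite sumr_const card_ord -mulr_natl; lra.
Qed.

End trigonometric_polynomials.

(** * Elementary inequalities and fourth differences *)

Section elementary_estimates.
Context {R : realType}.
Implicit Types (f g : R -> R) (x t u : R).

Lemma norm_sin_le x : `|sin x| <= `|x|.
Proof.
have := is_derive1_lipschitz R sin cos 1 (fun x => is_derive_sin x) (fun x => cos_max x) 0 x.
by rewrite sin0 !subr0 mul1r.
Qed.

Lemma subr_cos_le x : 1 - cos x <= x ^+ 2 / 2.
Proof.
have -> : 1 - cos x = 2 * `|sin (x / 2)| ^+ 2.
  rewrite real_normK ?num_real // sin2cos2 {1}(_ : x = (x / 2) *+ 2).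
    by rewrite cos_mulr2n -mulr_natl; ring.
  by rewrite -mulr_natl; field.
have : `|sin (x / 2)| ^+ 2 <= `|x / 2| ^+ 2 by rewrite lerXn2r ?nnegrE // norm_sin_le.
rewrite [X in _ <= X]real_normK ?num_real // expr_div_n; lra.
Qed.

Lemma ler_onem_exp u (L : nat) : 0 <= u <= 1 -> 1 - L%:R * u <= (1 - u) ^+ L.
Proof.
move=> /andP[u0 u1]; elim: L => [|L IH]; first by rewrite mul0r subr0 expr0.
rewrite exprS -natr1; apply: (@le_trans _ _ ((1 - u) * (1 - L%:R * u))).
  have : 0 <= L%:R * u ^+ 2 by rewrite mulr_ge0 ?sqr_ge0.
  nra.
by rewrite ler_wpM2l // subr_ge0.
Qed.

(** A second order counterpart of Bernoulli's inequality; it makes the derivative of a spike O(t^4)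
    at 0. *)
Lemma onem_exp_ler u (L : nat) : 0 <= u <= 1 ->
  (1 - u) ^+ L <= 1 - L%:R * u + L%:R ^+ 2 * u ^+ 2.
Proof.
move=> /andP[u0 u1]; elim: L => [|L IH]; first by rewrite expr0; lra.
rewrite exprS -natr1.
apply: (@le_trans _ _ ((1 - u) * (1 - L%:R * u + L%:R ^+ 2 * u ^+ 2))).
  by rewrite ler_wpM2l // subr_ge0.
have h1 : 0 <= L%:R * u ^+ 2 by rewrite mulr_ge0 ?sqr_ge0.
have h2 : 0 <= L%:R ^+ 2 * u ^+ 3 by rewrite mulr_ge0 ?exprn_ge0.
have h3 : 0 <= u ^+ 2 by rewrite sqr_ge0.
have -> : (1 - u) * (1 - L%:R * u + L%:R ^+ 2 * u ^+ 2) =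
  1 - (L%:R + 1) * u + (L%:R + L%:R ^+ 2) * u ^+ 2 - L%:R ^+ 2 * u ^+ 3 by ring.
have -> : (L%:R + 1) ^+ 2 * u ^+ 2 =
  (L%:R + L%:R ^+ 2) * u ^+ 2 + L%:R * u ^+ 2 + u ^+ 2 by ring.
lra.
Qed.

Lemma diff4E (h : R) f x : diff4 h f x =
  f (x - 2 * h) - 4 * f (x - h) + 6 * f x - 4 * f (x + h) + f (x + 2 * h).
Proof.
rewrite /diff4 !big_nat_recr //= big_geq // add0r.
rewrite (_ : 'C(4, 2) = 6%N) // !bin1 binn bin0 (_ : 'C(4, 3) = 4%N) //.
rewrite (_ : x - 2 * h + 0 * h = x - 2 * h); last by ring.
rewrite (_ : x - 2 * h + 1 * h = x - h); last by ring.
rewrite (_ : x - 2 * h + 2 * h = x); last by ring.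
rewrite (_ : x - 2 * h + 3 * h = x + h); last by ring.
rewrite (_ : x - 2 * h + 4 * h = x + 2 * h); last by ring.
rewrite !subSS !subn0 ?subnn; ring.
Qed.

Lemma diff4D (h : R) f g x :
  diff4 h (fun x => f x + g x) x = diff4 h f x + diff4 h g x.
Proof. by rewrite !diff4E; ring. Qed.

Lemma diff4Z (h c : R) f x : diff4 h (fun x => c * f x) x = c * diff4 h f x.
Proof. by rewrite !diff4E; ring. Qed.

Lemma diff4_shift (h a : R) f x : diff4 h (fun x => f (x - a)) x = diff4 h f (x - a).
Proof.
rewrite !diff4E.
by rewrite !(addrAC _ _ (- a)).
Qed.

Lemma diff4_bound (h M : R) f x : (forall x, `|f x| <= M) ->
  `|diff4 h f x| <= 16 * M.
Proof.
move=> fM; rewrite diff4E.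
have := fM (x - 2 * h); have := fM (x - h); have := fM x; have := fM (x + h).
have := fM (x + 2 * h); rewrite !ler_norml; lra.
Qed.

(** On a wave of frequency a the fourth central difference acts as multiplication by 16 sin(d/2)^4 =
    4 (1 - cos d)^2 with d = a h. *)
Lemma diff4_cos (h c a p x : R) :
  `|diff4 h (fun x => c * cos (a * x + p)) x| <= `|c| * (a * h) ^+ 4.
Proof.
rewrite diff4E; set b := a * x + p; set d := a * h.
rewrite (_ : a * (x - 2 * h) + p = b - d *+ 2); last by rewrite /b /d; ring.
rewrite (_ : a * (x + 2 * h) + p = b + d *+ 2); last by rewrite /b /d; ring.
rewrite (_ : a * (x - h) + p = b - d); last by rewrite /b /d; ring.
rewrite (_ : a * (x + h) + p = b + d); last by rewrite /b /d; ring.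
have := cos_mulr2n d; have := sin_mulr2n d; move: (d *+ 2) => e se ce.
move: b => b; rewrite !cosB !cosD se ce.
set z := (X in `|X| <= _).
have -> : z = c * cos b * (4 * (1 - cos d) ^+ 2) by rewrite /z; ring.
rewrite !normrM -mulrA ler_wpM2l //; apply: le_trans (ler_piMl _ (cos_max _)) _ => //.
rewrite ger0_norm // ger0_norm ?sqr_ge0 //.
have h1 := subr_cos_le d; have h2 := cos_le1 d.
have : (1 - cos d) ^+ 2 <= (d ^+ 2 / 2) ^+ 2.
  by rewrite lerXn2r ?nnegrE //; lra.
have -> : (d ^+ 2 / 2) ^+ 2 = d ^+ 4 / 4 by field.
lra.
Qed.

Lemma tp_diff4 n f f' : tp n f f' ->
  exists2 C : R, 0 <= C & forall h x, `|diff4 h f x| <= C * h ^+ 4.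
Proof.
elim=> [|k k' c j p _ _ [C C0 H]].
  by exists 0 => // h x; rewrite diff4E !mulr0 !subr0 !addr0 normr0 mul0r.
exists (C + `|c| * j%:R ^+ 4) => [|h x].
  by rewrite addr_ge0 ?mulr_ge0 ?exprn_ge0.
rewrite diff4D mulrDl; apply: le_trans (ler_normD _ _) (lerD (H _ _) _).
by rewrite -mulrA -exprMn; exact: diff4_cos.
Qed.

Lemma periodic_reduce f (a x : R) : (forall x, f (x + 2 * pi) = f x) ->
  exists2 y, a <= y <= a + 2 * pi & f x = f y.
Proof.
move=> fp.
have p0 : (0 : R) < 2 * pi by rewrite mulr_gt0 // pi_gt0.
have fpn y n : f (y + n%:R * (2 * pi)) = f y.
  elim: n => [|n IH]; first by rewrite mul0r addr0.
  by rewrite -natr1 mulrDl mul1r addrA fp.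
have fpz y (k : int) : f (y + k%:~R * (2 * pi)) = f y.
  case: k => n; first exact: fpn.
  by rewrite NegzE mulrNz mulNr -[RHS](fpn _ n.+1) -{2}[y](subrK (n.+1%:R * (2 * pi))) !fpn.
pose k : int := Num.floor ((x - a) / (2 * pi)).
exists (x - k%:~R * (2 * pi)); last by rewrite -mulNr -mulrNz fpz.
have /andP[] := mem_rg1_floor ((x - a) / (2 * pi)).
rewrite -/k ler_pdivlMr // ltr_pdivrMr //; lra.
Qed.

Lemma tp_bound_period n f f' (M : R) : tp n f f' ->
  (forall x, - pi <= x <= pi -> `|f x| <= M) -> forall x, `|f x| <= M.
Proof.
move=> tf fM x.
have [y y1 ->] := periodic_reduce f (- pi) x (fun x => tp_periodic _ _ _ x tf).
by apply: fM; move: y1; rewrite (_ : - pi + 2 * pi = pi) //; ring.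
Qed.

End elementary_estimates.

(** * Powers of (1 + cos t)/2: mean value and primitive *)

Section cosine_power.
Context {R : realType}.
Implicit Types t x : R.

Definition cpow (L : nat) (t : R) : R := ((1 + cos t) / 2) ^+ L.

(* Mean value of [cpow L] over a period and primitive of its deviation from the
   mean; both recursions integrate by parts. *)
Fixpoint cpow_mean (L : nat) : R :=
  if L is k.+1 then (2 * k + 1)%:R / (2 * k + 2)%:R * cpow_mean k else 1.

Fixpoint cpow_prim (L : nat) (t : R) : R :=
  if L is k.+1 then
    (2 * k + 1)%:R / (2 * k + 2)%:R * cpow_prim k t
    + (2 * k + 2)%:R^-1 * (cpow k t * sin t)
  else 0.

Lemma cpow_ge0 L t : 0 <= cpow L t.
Proof. by rewrite exprn_ge0 // divr_ge0 //; have := cos_geN1 t; lra. Qed.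

Lemma cpow_mean_gt0 L : 0 < cpow_mean L.
Proof.
by elim: L => [|L IH] //=; rewrite mulr_gt0 // divr_gt0 // ltr0n; lia.
Qed.

(** The mean is binomial(2L, L)/4^L, and this is the Wallis-type bound (L+1)^(-1/2). The induction
    step reduces to (2L+1)^2 (L+2) <= (2L+2)^2 (L+1). *)
Lemma cpow_mean_sqr L : cpow_mean L ^+ 2 * L.+1%:R <= 1.
Proof.
elim: L => [|L IH]; first by rewrite expr1n mul1r.
apply: le_trans IH.
rewrite /= exprMn mulrAC mulrC ler_wpM2l ?sqr_ge0 // expr_div_n mulrAC.
have d0 : (0 : R) < (2 * L + 2)%:R ^+ 2 by rewrite exprn_gt0 // ltr0n; lia.
by rewrite ler_pdivrMr // -!natrX -!natrM ler_nat; nia.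
Qed.

Lemma cpow_mean_le p : (0 < p)%N -> cpow_mean (p ^ 2) <= p%:R^-1.
Proof.
move=> p0; have q0 : (0 : R) < p%:R by rewrite ltr0n.
rewrite -[leRHS]mul1r ler_pdivlMr // -(ler_pXn2r (_ : (0 < 2)%N)) ?nnegrE ?mulr_ge0 //;
  last exact/ltW/cpow_mean_gt0.
rewrite expr1n exprMn; apply: le_trans (cpow_mean_sqr (p ^ 2)).
by rewrite ler_wpM2l ?sqr_ge0 // -natrX ler_nat.
Qed.

(** The integration by parts behind both recursions: sin^2 = (1 - cos)(1 + cos) restores the factor
    lost by differentiating the power. *)
Lemma cpow_sin_derive L t : is_derive t 1 (fun t => cpow L t * sin t)
  (cpow L t * (L.+1%:R * cos t - L%:R)).
Proof.
have -> : (fun t => cpow L t * sin t) =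
  ((2^-1 *: (cst 1 + cos : R -> R)) ^+ L * sin).
  by apply/funext => y; rewrite /cpow mulrC [RHS]mulrC; congr (_ * _);
     rewrite !fctE /= [_ *: _]mulrC.
have H : is_derive t 1 (2^-1 *: (cst 1 + cos : R -> R)) (- (sin t / 2)).
  by apply: is_derive_eq; rewrite add0r /GRing.scale /=; ring.
case: L => [|L].
  rewrite expr0; apply: is_derive_eq.
  by rewrite [X in X *: _](_ : _ = 1 :> R) // /cpow expr0 /GRing.scale /=; ring.
apply: is_derive_eq.
have e1 : (2^-1 *: (cst 1 + cos : R -> R)) t = (1 + cos t) / 2.
  by rewrite mulrC.
rewrite exprfctE e1 /cpow /GRing.scale /= exprS -!(natr1 L.+1) -!(natr1 L).
have := sin2cos2 t; set S := sin t; set C := cos t => E.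
set P := ((1 + C) / 2) ^+ L.
have -> : S * ((L%:R + 1) * P * - (S / 2)) = - (L%:R + 1) * P / 2 * S ^+ 2 by ring.
by rewrite E; field.
Qed.

Lemma cpow_prim_derive L t : is_derive t 1 (cpow_prim L) (cpow L t - cpow_mean L).
Proof.
elim: L => [|L IH] /=.
  by rewrite /cpow expr0 subrr; exact: is_derive_cst.
have H := cpow_sin_derive L t.
set a := _ / _; set b := _^-1.
have -> : (fun t => a * cpow_prim L t + b * (cpow L t * sin t)) =
  a *: (cpow_prim L) + b *: (fun t => cpow L t * sin t) by [].
apply: is_derive_eq; rewrite /GRing.scale /= /a /b /cpow exprS.
rewrite -/(cpow L t) (natrD _ (2 * L) 1) (natrD _ (2 * L) 2) (natrM _ 2 L) -natr1.
by field; rewrite -natrM -natrD pnatr_eq0; lia.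
Qed.

Lemma cpow_prim0 L : cpow_prim L 0 = 0.
Proof. by elim: L => [|L IH] //=; rewrite IH sin0 !mulr0 addr0. Qed.

Lemma cpow_prim_periodic L t : cpow_prim L (t + 2 * pi) = cpow_prim L t.
Proof.
elim: L => [|L IH] //=; rewrite IH /cpow.
by have := cosD2pin t 1; have := sinD2pin t 1; rewrite mul1r => -> ->.
Qed.

(** Adding [cpow_mean L * t] gives a function with derivative [cpow L] >= 0, which therefore
    increases from 0 to 2 pi [cpow_mean L] on [0, 2 pi]. *)
Lemma cpow_prim_bound L t : `|cpow_prim L t| <= 2 * pi * cpow_mean L.
Proof.
have [y /andP[]] := periodic_reduce (cpow_prim L) 0 t (cpow_prim_periodic L).
rewrite add0r => y0 y1 ->.
pose g (t : R) := cpow_prim L t + cpow_mean L * t.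
have dg x : is_derive x 1 g (cpow L x).
  have H := cpow_prim_derive L x.
  have -> : g = cpow_prim L + cpow_mean L *: (id : R -> R) by [].
  by apply: is_derive_eq; rewrite /GRing.scale /= mulr1 subrK.
have g0 : g 0 <= g y by apply: is_derive1_homo dg y0 _ => x _; exact: cpow_ge0.
have g1 : g y <= g (2 * pi) by apply: is_derive1_homo dg y1 _ => x _; exact: cpow_ge0.
have e0 : g 0 = 0 by rewrite /g cpow_prim0 mulr0 addr0.
have e1 : g (2 * pi) = cpow_mean L * (2 * pi).
  by rewrite /g -[X in cpow_prim L X]add0r cpow_prim_periodic cpow_prim0 add0r.
have : 0 <= cpow_mean L * y by rewrite mulr_ge0 // ltW // cpow_mean_gt0.
have : cpow_mean L * y <= cpow_mean L * (2 * pi).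
  by rewrite ler_wpM2l // ltW // cpow_mean_gt0.
move: g0 g1; rewrite e0 e1 /g ler_norml; lra.
Qed.

End cosine_power.

(** * The spike and its low-degree approximation *)

Section spike.
Context {R : realType}.
Variables (s m : nat).
Hypotheses (s_gt0 : (0 < s)%N) (s_ltm : (s < m)%N).
Implicit Types (t x : R).

Lemma tp_sin n (c : R) (j : nat) : (j <= n)%N ->
  tp n (fun x => c * sin (j%:R * x)) (fun x => c * j%:R * cos (j%:R * x)).
Proof.
move=> jn; apply: tp_ext (tp1 n c (- (pi / 2)) j jn) => x.
  by rewrite cosBpihalf.
by rewrite sinBpihalf mulrN opprK.
Qed.

Let carrier_prim x : R := s%:R^-1 * sin (s%:R * x).

Let tp_carrier_prim : tp s carrier_prim (fun x => cos (s%:R * x)).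
Proof.
apply: tp_ext (tp_sin s s%:R^-1 s _) => // x.
by rewrite mulVf ?mul1r // pnatr_eq0; lia.
Qed.

Let modulated_prim (k : nat) x : R :=
  (2 * (k + s)%:R)^-1 * sin ((k + s)%:R * x)
  + (2 * (k - s)%:R)^-1 * sin ((k - s)%:R * x).

Let tp_modulated_prim k : (s < k)%N ->
  tp (k + s) (modulated_prim k) (fun x => cos (s%:R * x) * cos (k%:R * x)).
Proof.
move=> sk.
apply: tp_ext (tpD _ _ _ _ _
  (tp_sin (k + s) (2 * (k + s)%:R)^-1 (k + s) _)
  (tp_sin (k + s) (2 * (k - s)%:R)^-1 (k - s) _)) => // [x|]; last by lia.
have h1 : (k + s)%:R != 0 :> R by rewrite pnatr_eq0; lia.
have h2 : (k - s)%:R != 0 :> R by rewrite pnatr_eq0; lia.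
have H (A c : R) : A != 0 -> (2 * A)^-1 * A * c = c / 2 by move=> A0; field.
rewrite !H //.
have -> : (k - s)%:R * x = k%:R * x - s%:R * x by rewrite natrB ?mulrBl // ltnW.
rewrite natrD mulrDl cosB cosD; lra.
Qed.

(** The additional factor cos(jmx) lets the induction on L close: multiplication by (1 + cos mx)/2
    averages the frequencies j-1, j, j+1 with weights 1/4, 1/2, 1/4. In the base case s < m keeps jm
    - s away from 0 for j >= 1. *)
Lemma tp_modulated_cpow (L j : nat) : exists d W, tp d W
  (fun x => cos (s%:R * x) * (cos ((j * m)%:R * x) * cpow L (m%:R * x))).
Proof.
elim: L j => [|L IH] j.
  case: j => [|j].
    exists s, carrier_prim; apply: tp_ext tp_carrier_prim => // x.
    by rewrite mul0n mul0r cos0 /cpow expr0 !mulr1.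
  exists (j.+1 * m + s)%N, (modulated_prim (j.+1 * m)).
  have sk : (s < j.+1 * m)%N by rewrite mulSn; lia.
  by apply: tp_ext (tp_modulated_prim _ sk) => // x; rewrite /cpow expr0 mulr1.
have [d [W TW]] := IH j; have [d1 [W1 TW1]] := IH j.+1.
(* For j = 0 the frequency -1 is replaced by 1, cosine being even. *)
have [d2 [W2 TW2]] : exists d W, tp d W
  (fun x => cos (s%:R * x) * (cos ((j%:R - 1) * (m%:R * x)) * cpow L (m%:R * x))).
  case: j {d W TW d1 W1 TW1} => [|j].
    have [d [W TW]] := IH 1%N; exists d, W; apply: tp_ext TW => // x.
    by rewrite mul1n sub0r mulN1r cosN.
  have [d [W TW]] := IH j; exists d, W; apply: tp_ext TW => // x.
  by rewrite -natr1 addrK natrM -(mulrA j%:R).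
exists (d + d1 + d2)%N; eexists.
apply: tp_ext (tpD _ _ _ _ _ (tpZ _ 2^-1 _ _ (tp_le d _ _ _ _ TW))
  (tpD _ _ _ _ _ (tpZ _ 4^-1 _ _ (tp_le d1 _ _ _ _ TW1))
                 (tpZ _ 4^-1 _ _ (tp_le d2 _ _ _ _ TW2)))) => //; [|lia..].
move=> x /=; rewrite /cpow exprS.
have -> : (j.+1 * m)%:R * x = j%:R * (m%:R * x) + m%:R * x.
  by rewrite natrM -natr1; ring.
have -> : (j * m)%:R * x = j%:R * (m%:R * x) by rewrite natrM mulrA.
have -> : (j%:R - 1) * (m%:R * x) = j%:R * (m%:R * x) - m%:R * x by ring.
rewrite cosB cosD; set P := _ ^+ L; by field.
Qed.

(** Here L = p^2, so that eta L = 2 and the mean mu is at most 1/p. The difference f - T is eta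
    times a primitive of cos(st)(w(mt) - mu); the fast oscillation of w(mt) - mu gives the factor
    1/m. *)
Lemma spike (p : nat) : (2 <= p)%N ->
  let eta : R := 2 / p%:R ^+ 2 in
  exists (d : nat) (f f' T T' : R -> R) (mu C : R),
  [/\ [/\ tp d f f', tp (m + s) T T' & f 0 = 0],
      [/\ forall t, 0 <= f' t * cos (s%:R * t), forall t, `|f' t| <= 2 &
          forall t, `|f' t| <= C * t ^+ 4],
      [/\ 0 <= mu, mu <= p%:R^-1 &
          forall t, T' t = cos (s%:R * t) * (1 - cos (m%:R * t) - eta + eta * mu)],
      forall t, `|f t - T t| <= eta * ((2 * pi + 2 * pi ^+ 2 * s%:R) * mu / m%:R) &
      forall h t, `|diff4 h T t| <= 6 * m%:R ^+ 3 * h ^+ 4].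
Proof.
move=> p2 eta.
have ms_gt0 : (0 < m + s)%N by lia.
have mBs_gt0 : (0 < m - s)%N by lia.
have p0 : (0 : R) < p%:R by rewrite ltr0n; lia.
have pp0 : (0 : R) < p%:R ^+ 2 by rewrite exprn_gt0.
have eta0 : 0 < eta by rewrite divr_gt0.
have etaL : eta * (p ^ 2)%:R = 2 by rewrite natrX /eta divfK ?gt_eqF.
have s0 : (0 : R) < s%:R by rewrite ltr0n.
have m0 : (0 : R) < m%:R by rewrite ltr0n; lia.
pose L := (p ^ 2)%N; pose mu : R := cpow_mean L.
have mu0 : 0 < mu := cpow_mean_gt0 L.
have mup : mu <= p%:R^-1 by apply: cpow_mean_le; lia.
have [d [W0 TW0]] := tp_modulated_cpow L 0.
pose W t := W0 t - W0 0.
have TW : tp d W (fun x => cos (s%:R * x) * cpow L (m%:R * x)).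
  apply: tp_ext (tpB _ _ _ _ _ TW0 (tp_cst d (W0 0))) => // x.
  by rewrite mul0n mul0r cos0 mul1r subr0.
have TM := tp_modulated_prim m s_ltm.
have TS := tp_carrier_prim.
pose e := (d + (m + s))%N.
have [de se me] : [/\ d <= e, s <= e & m + s <= e]%N by rewrite /e; split; lia.
have sms : (s <= m + s)%N by lia.
pose f t := (1 - eta) * carrier_prim t - modulated_prim m t + eta * W t.
pose f' t := (1 - eta) * cos (s%:R * t) - cos (s%:R * t) * cos (m%:R * t)
             + eta * (cos (s%:R * t) * cpow L (m%:R * t)).
pose T t := (1 - eta + eta * mu) * carrier_prim t - modulated_prim m t.
(* In terms of u = (1 - cos mt)/2 the bump is (1 - u)^L. Bernoulli's inequality gives f' the sign of
   cos(st), and its second order counterpart bounds |f'| by eta L^2 u^2. *)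
pose T' t := (1 - eta + eta * mu) * cos (s%:R * t) - cos (s%:R * t) * cos (m%:R * t).
pose u (t : R) : R := (1 - cos (m%:R * t)) / 2.
have u01 t : 0 <= u t <= 1.
  by rewrite /u; have := cos_le1 (m%:R * t); have := cos_geN1 (m%:R * t); lra.
have f'E t : f' t = cos (s%:R * t) * (2 * u t - eta + eta * (1 - u t) ^+ L).
  rewrite /f' /cpow (_ : (1 + _) / 2 = 1 - u t) /u; last by field.
  by set P := _ ^+ L; field.
have g0 t : 0 <= 2 * u t - eta + eta * (1 - u t) ^+ L.
  have /(ler_wpM2l (ltW eta0)) := ler_onem_exp (u t) L (u01 t).
  by rewrite mulrBr mulr1 mulrA etaL; lra.
have g4 t : 2 * u t - eta + eta * (1 - u t) ^+ L <= eta * L%:R ^+ 2 * u t ^+ 2.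
  have /(ler_wpM2l (ltW eta0)) := onem_exp_ler (u t) L (u01 t).
  by rewrite mulrDr mulrBr mulr1 !mulrA etaL; lra.
have g2 t : 2 * u t - eta + eta * (1 - u t) ^+ L <= 2.
  have /andP[h0 h1] := u01 t.
  have : (1 - u t) ^+ L <= 1 by rewrite exprn_ile1 //; lra.
  by move=> /(ler_wpM2l (ltW eta0)); rewrite mulr1; lra.
have tpf : tp e f f'.
  apply: tpD (tpZ _ _ _ _ (tp_le _ _ _ _ de TW)).
  apply: tpB (tpZ _ _ _ _ (tp_le _ _ _ _ se TS)) (tp_le _ _ _ _ me TM).
have tpT : tp (m + s) T T'.
  exact: tpB (tpZ _ _ _ _ (tp_le _ _ _ _ sms TS)) TM.
exists e, f, f', T, T', mu, (eta * L%:R ^+ 2 * m%:R ^+ 4 / 16).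
split=> //.
- split=> //; rewrite /f /carrier_prim /modulated_prim /W.
  by rewrite !mulr0 sin0; ring.
- split=> [t|t|t].
  + by rewrite f'E mulrC mulrA mulr_ge0 // -expr2 sqr_ge0.
  + rewrite f'E normrM; apply: le_trans (ler_piMl _ (cos_max _)) _ => //.
    by rewrite ger0_norm.
  + rewrite f'E normrM; apply: le_trans (ler_piMl _ (cos_max _)) _ => //.
    rewrite ger0_norm //; apply: le_trans (g4 t) _.
    have -> : eta * L%:R ^+ 2 * m%:R ^+ 4 / 16 * t ^+ 4 =
      eta * L%:R ^+ 2 * (((m%:R * t) ^+ 2 / 2) / 2) ^+ 2 by field.
    rewrite ler_wpM2l ?mulr_ge0 ?(ltW eta0) ?sqr_ge0 //.
    have /andP[h0 _] := u01 t; have := subr_cos_le (m%:R * t) => h1.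
    by rewrite lerXn2r ?nnegrE //; move: h0; rewrite /u; lra.
- by split=> // [|t]; [exact: ltW|rewrite /T'; ring].
- move=> t; have fTE x : f x - T x = eta * (W x - mu * carrier_prim x).
    by rewrite /f /T; ring.
  rewrite fTE normrM gtr0_norm // ler_pM2l //.
  have TD := tpB _ _ _ _ _ (tp_le _ _ _ _ de TW) (tpZ _ mu _ _ (tp_le _ _ _ _ se TS)).
  apply: (tp_bound_period e _ _ _ TD) => {}t tpi.
  pose B : R := 2 * pi * mu.
  (* Integration by parts: once the boundary term is subtracted, the derivative only contains s
     sin(sx) [cpow_prim L (m x)] / m, of size s mu/m. *)
  pose D x := (W x - mu * carrier_prim x) - m%:R^-1 * (cos (s%:R * x) * cpow_prim L (m%:R * x)).
  have dD x : is_derive x 1 D (m%:R^-1 * (s%:R * sin (s%:R * x) * cpow_prim L (m%:R * x))).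
    have h1 := tp_derive _ _ _ x TD.
    have h2 := is_derive1_cos_affine R 1 s%:R 0 x.
    have h3 : is_derive x 1 (fun x : R => m%:R * x) m%:R.
      have -> : (fun x : R => m%:R * x) = m%:R *: (id : R -> R) by [].
      by apply: is_derive_eq; rewrite /GRing.scale /= mulr1.
    have h4 := is_derive1_comp (cpow_prim_derive L (m%:R * x)) h3.
    have -> : D = (fun x => W x - mu * carrier_prim x) -
       m%:R^-1 *: ((fun x => 1 * cos (s%:R * x + 0)) * (cpow_prim L \o (fun x : R => m%:R * x))).
      by apply/funext => y; rewrite /D /= !fctE /= addr0 mul1r.
    apply: is_derive_eq; rewrite /GRing.scale /= !addr0 /mu; field.
    by rewrite gt_eqF.
  have D0 : D 0 = 0.
    by rewrite /D /W /carrier_prim subrr !mulr0 sin0 cpow_prim0 !mulr0 !subr0.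
  have Bb x : `|cpow_prim L x| <= B := cpow_prim_bound L x.
  have B0 : 0 <= B := le_trans (normr_ge0 _) (Bb 0).
  have := is_derive1_lipschitz _ _ _ (m%:R^-1 * (s%:R * B)) dD _ 0 t.
  rewrite D0 !subr0 => /(_ _) DB.
  have {}DB : `|D t| <= m%:R^-1 * (s%:R * B) * pi.
    apply: le_trans (DB _) _ => [x|].
      rewrite !normrM normfV !normr_nat ler_pM2l ?invr_gt0 //.
      by rewrite -mulrA ler_pM2l // -[B]mul1r ler_pM // ?sin_max.
    by rewrite ler_wpM2l ?ler_norml // mulr_ge0 ?invr_ge0 ?ler0n // mulr_ge0.
  have -> : W t - mu * carrier_prim t =
    D t + m%:R^-1 * (cos (s%:R * t) * cpow_prim L (m%:R * t)) by rewrite /D subrK.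
  apply: le_trans (ler_normD _ _) _.
  have -> : (2 * pi + 2 * pi ^+ 2 * s%:R) * mu / m%:R =
     m%:R^-1 * (s%:R * B) * pi + m%:R^-1 * B by rewrite /B; ring.
  rewrite lerD // normrM normfV normr_nat ler_pM2l ?invr_gt0 //.
  by rewrite normrM -[B]mul1r ler_pM ?cos_max.
- move=> h t.
  have b1 : `|1 - eta + eta * mu| <= 1.
    have eta1 : eta <= 2^-1.
      rewrite /eta ler_pdivrMr // mulrC ler_pdivlMr //.
      have : (2 : R) <= p%:R by rewrite (ler_nat R 2).
      nra.
    have mu1 : mu <= 1.
      by apply: le_trans mup _; rewrite invf_le1 // ler1n; lia.
    rewrite ler_norml; have := mulr_ge0 (ltW eta0) (ltW mu0).
    by have := ler_wpM2l (ltW eta0) mu1; rewrite mulr1; lra.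
  have sin4 (c : R) (a : nat) x : 
     `|diff4 h (fun x => c * sin (a%:R * x)) x| <= `|c| * (a%:R * h) ^+ 4.
    have := diff4_cos h c a%:R (- (pi / 2)) x.
    congr (`|_| <= _); congr diff4; apply/funext => y.
    by rewrite cosBpihalf.
  have TE : T = fun t => ((1 - eta + eta * mu) / s%:R) * sin (s%:R * t) +
     (- (2 * (m + s)%:R)^-1 * sin ((m + s)%:R * t)
     + - (2 * (m - s)%:R)^-1 * sin ((m - s)%:R * t)).
    by apply/funext => y; rewrite /T /carrier_prim /modulated_prim; ring.
  rewrite TE !diff4D.
  have x1 := sin4 ((1 - eta + eta * mu) / s%:R) s t.
  have h4 : 0 <= h ^+ 4 by rewrite exprn_even_ge0.
  (* The amplitude 1/(2a) cancels one of the four powers of the frequency a. With s and m - s at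
     most m and m + s at most 2m, the total is at most (1 + 4 + 1/2) m^3, below 6 m^3. *)
  have half (a : nat) : (0 < a)%N ->
     `|diff4 h (fun x => - (2 * a%:R)^-1 * sin (a%:R * x)) t|
       <= a%:R ^+ 3 / 2 * h ^+ 4.
    move=> a0; have a1 : (0 : R) < a%:R by rewrite ltr0n.
    apply: le_trans (sin4 _ _ _) _.
    rewrite normrN ger0_norm ?invr_ge0 ?mulr_ge0 ?ler0n //.
    by rewrite le_eqVlt; apply/orP; left; apply/eqP; field; rewrite gt_eqF.
  have x2 := half (m + s)%N ms_gt0.
  have x3 := half (m - s)%N mBs_gt0.
  have {}x1 : `|diff4 h (fun x => (1 - eta + eta * mu) / s%:R * sin (s%:R * x)) t|
      <= s%:R ^+ 3 * h ^+ 4.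
    apply: le_trans x1 _; rewrite normrM normfV (ger0_norm (ltW s0)).
    have -> : s%:R ^+ 3 * h ^+ 4 = 1 * (s%:R^-1 * (s%:R * h) ^+ 4) :> R.
      by field; rewrite gt_eqF.
    rewrite -mulrA ler_wpM2r // mulr_ge0 ?invr_ge0 ?ler0n //.
    by rewrite exprn_even_ge0.
  apply: le_trans (ler_normD _ _) _; apply: le_trans (lerD x1 (ler_normD _ _)) _.
  apply: le_trans (lerD (lexx _) (lerD x2 x3)) _.
  rewrite -!mulrDl ler_wpM2r //.
  have y1 : s%:R ^+ 3 <= m%:R ^+ 3 :> R.
    by rewrite lerXn2r ?nnegrE ?ler0n // ler_nat ltnW.
  have y2 : (m - s)%:R ^+ 3 <= m%:R ^+ 3 :> R.
    by rewrite lerXn2r ?nnegrE ?ler0n // ler_nat leq_subr.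
  have y3 : (m + s)%:R ^+ 3 <= (2 * m%:R) ^+ 3 :> R.
    have ms : (m + s)%:R <= 2 * m%:R :> R.
      have : s%:R <= m%:R :> R by rewrite ler_nat ltnW.
      by rewrite natrD; lra.
    by rewrite lerXn2r // nnegrE ?mulr_ge0 ?ler0n.
  rewrite exprMn in y3.
  have := exprn_ge0 3 (ltW m0); lra.
Qed.

End spike.

(** * Limsup, modulus of smoothness, best approximation and almost comonotonicity *)

Section functionals.
Context {R : realType}.
Implicit Types (f P : R -> R) (x : R).

Lemma limn_esup_pinfty (u : nat -> R) :
  (forall (A : R) (N : nat), exists2 n, (N <= n)%N & A <= u n) ->
  limn_esup (fun n => (u n)%:E) = +oo%E.
Proof.
move=> uA; rewrite /limn_esup /limf_esup.
apply/eqP; rewrite -leye_eq; apply: le_ereal_inf_tmp => _ [V [N _ NV] <-].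
rewrite leye_eq; apply/eqP/eqyP => A _.
have [n Nn An] := uA A N.
apply: le_trans (ereal_sup_ubound _); last by exists n => //; exact: NV.
by rewrite lee_fin.
Qed.

Lemma bounded_second_diff0 (b : nat -> R) (M : R) : (forall n, `|b n| <= M) ->
  (forall n, b n.+2 - 2 * b n.+1 + b n = 0) -> forall n, b n.+1 = b n.
Proof.
move=> bM b2.
have E n : b n = b 0%N + n%:R * (b 1%N - b 0%N).
  suff [] : b n = b 0%N + n%:R * (b 1%N - b 0%N) /\
         b n.+1 = b 0%N + n.+1%:R * (b 1%N - b 0%N) by [].
  elim: n => [|n [h1 h2]]; first by split; ring.
  split=> //; have := b2 n; rewrite h1 h2 -!natr1 => h; rewrite -[LHS]subr0 -h; ring.
suff c0 : b 1%N - b 0%N = 0 by move=> n; rewrite (E n.+1) (E n) c0 !mulr0.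
apply/eqP/negP => /negP c0.
have c1 : 0 < `|b 1%N - b 0%N| by rewrite normr_gt0.
pose n := (Num.truncn (2 * M / `|b 1%N - b 0%N|)).+1.
have : 2 * M / `|b 1%N - b 0%N| < n%:R by rewrite truncnS_gt.
rewrite ltr_pdivrMr // -{1}(normr_nat R n) -normrM.
have -> : n%:R * (b 1%N - b 0%N) = b n - b 0%N by rewrite (E n); ring.
apply/negP; rewrite -leNgt; apply: le_trans (ler_normB _ _) _.
by have := bM n; have := bM 0%N; lra.
Qed.

(** Along a progression of step h, bounded sequences with zero second difference are constant; this
    applies in turn to the second differences, the first differences and the values of f. Two
    arbitrary points are joined by equal steps of length at most t. *)
Lemma bounded_diff4_eq0 f (M t : R) : 0 < t -> (forall x, `|f x| <= M) ->
  (forall h x, 0 < h <= t -> diff4 h f x = 0) -> forall x y, f x = f y.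
Proof.
move=> t0 fM f4.
have step h x : 0 < h <= t -> f (x + h) = f x.
  move=> ht; pose a (n : nat) := f (x + n%:R * h).
  have aM n : `|a n| <= M := fM _.
  pose d1 n := a n.+1 - a n; pose d2 n := d1 n.+1 - d1 n.
  have d1M n : `|d1 n| <= 2 * M.
    by apply: le_trans (ler_normB _ _) _; have := aM n; have := aM n.+1; lra.
  have d2M n : `|d2 n| <= 2 * (2 * M).
    by apply: le_trans (ler_normB _ _) _; have := d1M n; have := d1M n.+1; lra.
  have a4 n : d2 n.+2 - 2 * d2 n.+1 + d2 n = 0.
    have := f4 h (x + n.+2%:R * h) ht; rewrite diff4E => <-.
    rewrite /d2 /d1 /a -(natr1 n.+3) -(natr1 n.+2) -(natr1 n.+1) -(natr1 n).
    rewrite (_ : x + (n%:R + 1 + 1) * h - 2 * h = x + n%:R * h); last by ring.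
    rewrite (_ : x + (n%:R + 1 + 1) * h - h = x + (n%:R + 1) * h); last by ring.
    rewrite (_ : x + (n%:R + 1 + 1) * h + h = x + (n%:R + 1 + 1 + 1) * h); last by ring.
    rewrite (_ : x + (n%:R + 1 + 1) * h + 2 * h = x + (n%:R + 1 + 1 + 1 + 1) * h);
      last by ring.
    ring.
  have d20 := bounded_second_diff0 _ _ d2M a4.
  have d10 : forall n, d1 n.+1 = d1 n.
    apply: (bounded_second_diff0 _ _ d1M) => n; have := d20 n; rewrite /d2; lra.
  have := bounded_second_diff0 _ _ aM _ 0%N.
  rewrite /a mul0r addr0 mul1r; apply=> n.
  by have := d10 n; rewrite /d1 /a; lra.
have le_eq x y : x <= y -> f x = f y.
  rewrite le_eqVlt => /predU1P[-> //|xy].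
  pose n := (Num.truncn ((y - x) / t)).+1.
  have n0 : (0 : R) < n%:R by rewrite ltr0n.
  have ht : 0 < (y - x) / n%:R <= t.
    rewrite divr_gt0 ?subr_gt0 //= ler_pdivrMr // mulrC -ler_pdivrMr //.
    by rewrite ltW // truncnS_gt.
  have H k : f (x + k%:R * ((y - x) / n%:R)) = f x.
    elim: k => [|k IH]; first by rewrite mul0r addr0.
    by rewrite -natr1 mulrDl mul1r addrA step.
  by rewrite -(H n); congr f; field; rewrite gt_eqF.
by move=> x y; have [/le_eq|/ltW/le_eq] := leP x y.
Qed.

Lemma omega4_le f (t B : R) : 0 < t ->
  (forall h x, 0 < h <= t -> `|diff4 h f x| <= B) -> omega4 f t <= B.
Proof.
move=> t0 fB; apply: ge_sup.
  by eexists; exists t => //=; rewrite in_itv /= t0 lexx.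
move=> _ /= [h + <-]; rewrite in_itv /= => ht; apply: ge_sup; last first.
  by move=> _ [x _ <-]; exact: fB.
exists `|diff4 h f 0|; exists 0 => //=; rewrite in_itv /= oppr_le0.
by rewrite pi_ge0.
Qed.

(** Needed because division by 0 gives 0: the quotient in the theorem is large only if its
    denominator is positive. *)
Lemma omega4_gt0 f (t M x y : R) : 0 < t -> (forall x, `|f x| <= M) ->
  (forall x, f (x + 2 * pi) = f x) -> f x != f y -> 0 < omega4 f t.
Proof.
move=> t0 fM fp; rewrite ltNge; apply: contraNN => o0; apply/eqP.
apply: (bounded_diff4_eq0 f M t t0 fM) => h w ht.
have fpd z : diff4 h f (z + 2 * pi) = diff4 h f z.
  by rewrite !diff4E !(addrAC _ (2 * pi)) !fp.
have [z z1 ->] := periodic_reduce (diff4 h f) (- pi) w fpd.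
rewrite (_ : - pi + 2 * pi = pi) in z1; last by ring.
have B h' z' : `|diff4 h' f z'| <= 16 * M by apply: diff4_bound.
apply/eqP; rewrite -normr_le0; apply: le_trans o0.
have in_h : `|diff4 h f z| <= sup [set `|diff4 h f x| | x in `[- pi, pi]].
  apply: ub_le_sup; first by exists (16 * M) => _ [v _ <-].
  by exists z => //=; rewrite in_itv.
apply: le_trans in_h _; apply: ub_le_sup; last first.
  by exists h => //=; rewrite in_itv.
exists (16 * M) => _ [h' _ <-]; apply: ge_sup => [|_ [v _ <-]//].
exists `|diff4 h' f z|; exists z => //=; by rewrite in_itv.
Qed.

Lemma sup_norm_ub f (M x : R) : (forall x, `|f x| <= M) -> `|f x| <= sup_norm f.
Proof.
by move=> fM; apply: ub_le_sup; [exists M => _ [w _ <-]|exists x].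
Qed.

Lemma almost_comonotone_cst (s : nat) (y : int -> R) (e c : R) : 0 <= e ->
  almost_comonotone s y e (fun=> c).
Proof.
move=> e0; rewrite /almost_comonotone /=.
rewrite (_ : [set x | _ /\ _] = `[- pi, pi]%classic); last first.
  apply/seteqP; split => x /=; first by case.
  by move=> xp; split=> //; rewrite (_ : (fun=> c) = cst c) // derive1_cst mul0r.
rewrite lebesgue_measure_itv /= lte_fin.
have p0 := pi_gt0 R.
by rewrite ifT; [rewrite -EFinB lee_fin; lra|lra].
Qed.

Lemma trig_poly_cst n (c : R) : trig_poly n (fun=> c).
Proof.
exists c, (fun=> 0), (fun=> 0) => x.
by rewrite big1 ?addr0 // => j _; rewrite !mul0r addr0.
Qed.

(** Constants are admissible, so the infimum is over a nonempty set and lower bounds pass to it. *)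
Lemma E1_ge (s n : nat) (y : int -> R) f (e B : R) : 0 <= e ->
  (forall P, trig_poly n P -> almost_comonotone s y e P -> B <= sup_norm (f \- P)) ->
  B <= E1 s y n f e.
Proof.
move=> e0 H; apply: lb_le_inf => [|_ [P [nP cP] <-]]; last exact: H.
exists (sup_norm (f \- (fun=> 0))), (fun=> 0) => //.
by split; [exact: trig_poly_cst|exact: almost_comonotone_cst].
Qed.

Lemma measure_equidistant_itvs (c rho tau : R) (N : nat) : 0 < rho -> 2 * rho < tau ->
  let B := \big[setU/set0]_(k < N) `[c + k%:R * tau - rho, c + k%:R * tau + rho]%classic in
  measurable B /\ lebesgue_measure B = (N%:R * (2 * rho))%:E.
Proof.
move=> r0 rt B.
pose F (k : nat) : set R := `[c + k%:R * tau - rho, c + k%:R * tau + rho]%classic.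
have mF k : measurable (F k) by exact: measurable_itv.
split; first by apply: bigsetU_measurable => k _; exact: mF.
have tF : trivIset setT F.
  apply/trivIsetP => i j _ _; wlog ij : i j / (i < j)%N.
    move=> H; rewrite neq_ltn => /orP[ij|ji]; first by apply: H; rewrite ?ltn_eqF.
    by rewrite setIC; apply: H; rewrite ?ltn_eqF.
  move=> _; apply/seteqP; split=> // x; rewrite /F /= !in_itv /= => -[/andP[_ h1] /andP[h2 _]].
  have : i%:R + 1 <= j%:R :> R by rewrite natr1 ler_nat.
  have tau0 : 0 < tau by lra.
  move=> /(ler_wpM2r (ltW tau0)); lra.
have -> : lebesgue_measure B = (\sum_(k < N) lebesgue_measure (F k))%E.
  exact: (@measure_bigsetU _ _ _ (@lebesgue_measure R) F mF tF N).
rewrite (eq_bigr (fun=> (2 * rho)%:E)) => [|k _]; last first.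
  rewrite lebesgue_measure_itv /= lte_fin ifT; last by lra.
  by rewrite -EFinB; congr (_%:E); ring.
by rewrite sumEFin sumr_const card_ord [in RHS]mulr_natl.
Qed.

(** The N disjoint intervals have total length N 2 rho > e, so they cannot all avoid a set that
    misses at most e of the period. *)
Lemma almost_comonotone_meets (s N : nat) (y : int -> R) (e c rho tau : R) P :
  almost_comonotone s y e P -> 0 < rho -> 2 * rho < tau -> e < N%:R * (2 * rho) ->
  - pi <= c - rho -> c + N%:R * tau <= pi ->
  exists k x, [/\ (k < N)%N, `|x - (c + k%:R * tau)| <= rho &
    0 <= derive1 P x * PiY s y x].
Proof.
rewrite /almost_comonotone /=; set A := [set x | _ /\ _] => mA r0 rt eN c1 c2.
apply: contrapT => H.
have [mB EB] := measure_equidistant_itvs c rho tau N r0 rt.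
set B := \big[setU/set0]_(k < N) _ in mB EB.
pose F (k : nat) : set R := `[c + k%:R * tau - rho, c + k%:R * tau + rho]%classic.
have BE : B = \bigcup_(k < N) F k by rewrite bigcup_mkord.
have AB : A `<=` `[- pi, pi]%classic `\` B.
  move=> x [xp xA]; split=> //; rewrite BE => -[k /= kN xk].
  apply: H; exists k, x; split=> //.
  by move: xk; rewrite /F /= in_itv /= ler_distl.
have Bp : B `<=` `[- pi, pi]%classic.
  move=> x; rewrite BE => -[k /= kN]; rewrite /F /= !in_itv /=.
  have tau0 : 0 < tau by lra.
  have h1 : 0 <= k%:R * tau by rewrite mulr_ge0 // ltW.
  have : k%:R + 1 <= N%:R :> R by rewrite natr1 ler_nat.
  by move=> /(ler_wpM2r (ltW tau0)); rewrite mulrDl mul1r; lra.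
have pi0 := pi_gt0 R.
have mI : lebesgue_measure (`[- pi, pi]%classic : set R) = (2 * pi)%:E.
  rewrite lebesgue_measure_itv /= lte_fin ifT; last by lra.
  by rewrite -EFinB; congr (_%:E); ring.
pose J : set R := `[- pi, pi]%classic.
(* Measurability of [A] has not been established, so monotonicity is taken from the outer
   measure. *)
have : (lebesgue_measure A <= lebesgue_measure (J `\` B))%E.
  exact: (le_outer_measure (wlength idfun)^*%mu).
have mJ : (lebesgue_measure J < +oo)%E by rewrite /J mI ltry.
have -> : lebesgue_measure (J `\` B) = (lebesgue_measure J - lebesgue_measure (J `&` B))%E.
  by apply: measureD => //; exact: measurable_itv.
rewrite (setIidr Bp) /J mI EB -EFinB => h.
have := le_trans mA h; rewrite lee_fin; lra.
Qed.

End functionals.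

(** * Lower bounds from Bernstein's inequality and perturbation of omega_4 *)

Section approximation.
Context {R : realType}.
Implicit Types (f P H : R -> R) (x t : R).

(** Bernstein's inequality for P - H gives b <= 2n (|f - P| + b/(8n)) = 2n |f - P| + b/4, with |f -
    P| the sup norm. *)
Lemma sup_norm_bernstein n P P' H H' f (b M x : R) : (0 < n)%N ->
  tp n P P' -> tp n H H' -> (forall x, `|f x| <= M) ->
  (forall x, `|f x - H x| <= b / (8 * n%:R)) -> b <= P' x - H' x ->
  3 * b / (8 * n%:R) <= sup_norm (f \- P).
Proof.
move=> n0 tP tH fM fH bPH.
have n1 : (0 : R) < n%:R by rewrite ltr0n.
have [MP PM] := tp_bounded _ _ _ tP.
have fPM z : `|(f \- P) z| <= M + MP.
  by apply: le_trans (ler_normB _ _) (lerD (fM _) (PM _)).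
have fP z := sup_norm_ub (f \- P) _ z fPM.
have QM z : `|P z - H z| <= sup_norm (f \- P) + b / (8 * n%:R).
  have -> : P z - H z = - (f \- P) z + (f z - H z) by rewrite /=; ring.
  by apply: le_trans (ler_normD _ _) _; rewrite normrN lerD.
have := bernstein _ _ _ _ (tpB _ _ _ _ _ tP tH) QM x.
move=> /(le_trans (ler_norm _)) /(le_trans bPH).
have -> : 2 * n%:R * (sup_norm (f \- P) + b / (8 * n%:R)) =
  2 * n%:R * sup_norm (f \- P) + b / 4 by field; rewrite gt_eqF.
rewrite ler_pdivrMr ?mulr_gt0 //; lra.
Qed.

Lemma omega4_perturb f H (e C t : R) : 0 < t -> 0 <= C ->
  (forall x, `|f x - H x| <= e) -> (forall h x, `|diff4 h H x| <= C * h ^+ 4) ->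
  omega4 f t <= 16 * e + C * t ^+ 4.
Proof.
move=> t0 C0 fH HC; apply: omega4_le => // h x /andP[h0 ht].
have -> : f = fun x => (f x - H x) + H x by apply/funext => z; rewrite subrK.
rewrite diff4D; apply: le_trans (ler_normD _ _) (lerD _ _).
  exact: diff4_bound.
apply: le_trans (HC _ _) _; rewrite ler_wpM2l // lerXn2r ?nnegrE //; exact: ltW.
Qed.

Lemma cos_near_peak (m k : nat) (r t : R) : (0 < m)%N ->
  `|t - k%:R * (2 * pi / m%:R)| <= r / m%:R -> 1 - cos (m%:R * t) <= r ^+ 2 / 2.
Proof.
move=> m0 tr; have m1 : (0 : R) < m%:R by rewrite ltr0n.
pose v := m%:R * (t - k%:R * (2 * pi / m%:R)).
have -> : cos (m%:R * t) = cos v.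
  by rewrite -(cosD2pin v k); congr cos; rewrite /v; field; rewrite gt_eqF.
apply: le_trans (subr_cos_le _) _; rewrite ler_pM2r ?invr_gt0 //.
rewrite -[v ^+ 2]real_normK ?num_real //.
have vr : `|v| <= r.
  by rewrite /v normrM gtr0_norm // mulrC -ler_pdivlMr.
by rewrite lerXn2r ?nnegrE // (le_trans _ vr).
Qed.

Lemma exists_large (a : R) (b : nat) : exists2 n, (b <= n)%N & a <= n%:R.
Proof.
exists (b + (Num.truncn a).+1)%N; first exact: leq_addr.
apply: le_trans (ltW (truncnS_gt a)) _; rewrite ler_nat; exact: leq_addl.
Qed.

End approximation.

(** * Equidistant nodes *)

Section equidistant_nodes.
Context {R : realType}.
Variable s : nat.
Hypothesis s_gt0 : (0 < s)%N.
Implicit Types (t x : R) (f F g : R -> R).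

(** These are the zeros of cos(s(x - [eqd_mid])), so that one cosine carries the whole sign pattern;
    y_0 = pi and y_(2s) = -pi. *)
Definition eqd_node (i : int) : R := pi - i%:~R * (pi / s%:R).

Definition eqd_mid : R := pi - pi / (2 * s%:R).

(** For x between y_1 and y_0 every x - y_i with 1 <= i <= 2s lies in (0, 2 pi), so all the sines
    are positive. *)
Lemma PiY_eqd_gt0 x : `|x - eqd_mid| < pi / (2 * s%:R) -> 0 < PiY s eqd_node x.
Proof.
rewrite ltr_norml => /andP[x1 x2]; rewrite /PiY big_nat.
apply: prodr_gt0 => i /andP[i1 i2]; apply: sin_gt0_pi.
have s0 : (0 : R) < s%:R by rewrite ltr0n.
have p0 := pi_gt0 R.
pose q : R := pi / (2 * s%:R).
have q0 : 0 < q by rewrite divr_gt0 ?mulr_gt0.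
have pE : pi = 2 * s%:R * q by rewrite /q; field; rewrite gt_eqF.
have -> : x - eqd_node i%:Z = x - eqd_mid + (2 * i%:R - 1) * q.
  by rewrite /eqd_node /eqd_mid /q; field; rewrite gt_eqF.
have j1 : (1 : R) <= i%:R by rewrite ler1n.
have j2 : (i%:R : R) <= 2 * s%:R by rewrite -natrM ler_nat.
have e1 : 0 <= (i%:R - 1) * q by rewrite mulr_ge0 ?(ltW q0) // subr_ge0.
have e2 : 0 <= (2 * s%:R - i%:R) * q by rewrite mulr_ge0 ?(ltW q0) // subr_ge0.
rewrite -/q in x1 x2; move: pE e1 e2; rewrite !mulrBl mul1r; lra.
Qed.

(** The variable is t = x - [eqd_mid]. The flatness at 0 makes an existing partial sum harmless
    where the next spike is tested. *)
Definition flat_comonotone F := exists d F' (C : R), [/\ tp d F F',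
  forall t, 0 <= F' t * cos (s%:R * t) & forall t, `|F' t| <= C * t ^+ 4].

End equidistant_nodes.

(** * Properties of a single spike *)

Section spike_step.
Context {R : realType}.
Variable s : nat.
Hypothesis s_gt0 : (0 < s)%N.
Implicit Types (t x : R) (f F g : R -> R).

(** The last two bounds do not depend on the spike; they give uniform convergence of the series and
    a Lipschitz limit. *)
Definition spike_like g := [/\ flat_comonotone s g,
  forall a b, `|g b - g a| <= 2 * `|b - a| & forall x, `|g x| <= 2 * pi].

Lemma tp_spike_like d g g' (C : R) : tp d g g' -> g 0 = 0 ->
  (forall t, 0 <= g' t * cos (s%:R * t)) -> (forall t, `|g' t| <= 2) ->
  (forall t, `|g' t| <= C * t ^+ 4) -> spike_like g.
Proof.
move=> tg g0 gs g2 gC.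
have gL := is_derive1_lipschitz _ _ _ 2 (fun x => tp_derive _ _ _ x tg) g2.
split=> //; first by exists d, g', C.
apply: (tp_bound_period d _ _ _ tg) => x xp; have := gL 0 x.
by rewrite g0 !subr0 => /le_trans; apply; rewrite ler_pM2l // ler_norml.
Qed.

(** Within 1/(l^4 m) of a peak, 1 - cos(mt) <= eta/4, and mu <= 1/16. The bracket is then at most
    -(1 - 1/4 - 1/16) eta = -(11/16) eta, and cos(st) >= 1/2 halves this. *)
Lemma spike_slope (l m k : nat) (mu eta t : R) : (2 <= l)%N -> (0 < m)%N ->
  0 <= mu <= (l ^ 4)%:R^-1 -> 2^-1 <= cos (s%:R * t) ->
  `|t - k%:R * (2 * pi / m%:R)| <= (l ^ 4)%:R^-1 / m%:R ->
  eta = 2 / (l ^ 4)%:R ^+ 2 ->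
  cos (s%:R * t) * (1 - cos (m%:R * t) - eta + eta * mu) <= - (11 / 32) * eta.
Proof.
move=> l2 m0 /andP[mu0 mu1] ct tk etaE.
have cm := cos_near_peak _ _ _ _ m0 tk.
have p16 : (16 : R) <= (l ^ 4)%:R.
  by rewrite ler_nat -[16%N]/(2 ^ 4)%N leq_exp2r.
have p0 : (0 : R) < (l ^ 4)%:R by lra.
have eta0 : 0 < eta by rewrite etaE divr_gt0 // exprn_gt0.
have cm' : 1 - cos (m%:R * t) <= eta / 4.
  apply: le_trans cm _; rewrite etaE exprVn; set q := _^-1; lra.
have mu16 : mu <= 16^-1.
  by apply: le_trans mu1 _; rewrite lef_pV2 ?posrE.
have emu : eta * mu <= eta / 16 by rewrite ler_pM2l.
have h : 1 - cos (m%:R * t) - eta + eta * mu <= - (11 / 16) * eta by lra.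
have c0 : 0 <= cos (s%:R * t) by apply: le_trans ct; rewrite invr_ge0.
apply: le_trans (ler_wpM2l c0 h) _.
have := ler_wpM2l (_ : 0 <= 11 / 16 * eta) ct; rewrite mulr_ge0 ?(ltW eta0) //.
by move=> /(_ isT); rewrite mulrC; lra.
Qed.

End spike_step.

(** * A point near 0 where P has nonnegative slope *)

Section lower_bound.
Context {R : realType}.
Variables (s : nat) (eps : nat -> R).
Hypotheses (s_gt0 : (0 < s)%N)
  (eps_ge0 : forall n : nat, (0 < n)%N -> 0 <= eps n)
  (eps_cvg0 : eps n @[n --> \oo] --> (0 : R)).
Implicit Types (t x : R) (f F g P : R -> R).

Lemma eps_eventually_lt (e : R) (b : nat) : 0 < e ->
  exists2 N, (b <= N)%N & forall n, (N <= n)%N -> eps n < e.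
Proof.
move=> e0; have /cvgrPdist_lt /(_ e e0) [N _ HN] := eps_cvg0.
exists (b + N)%N => [|n Nn]; first exact: leq_addr.
have := HN n (leq_trans (leq_addl _ _) Nn).
by rewrite sub0r normrN; apply: le_lt_trans (ler_norm _).
Qed.

(** N intervals with spacing 2 pi/m, starting at [eqd_mid], fill a stretch of length pi/(8 s r),
    inside (y_1, y_0) where Pi > 0. Their total length rho/(8 s r) does not depend on N, so N may be
    chosen afterwards to beat [eps]. *)
Lemma comonotone_nonneg_slope (N m n r : nat) (rho : R) P :
  (0 < N)%N -> (0 < r)%N -> m = (16 * s * r * N)%N ->
  0 < rho <= 1 -> eps n < N%:R * (2 * (rho / m%:R)) ->
  trig_poly n P -> almost_comonotone s (eqd_node s) (eps n) P ->
  exists P' k t, [/\ tp n P P', `|t - k%:R * (2 * pi / m%:R)| <= rho / m%:R,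
    `|t| <= 1 / (s%:R * r%:R) & 0 <= P' (t + eqd_mid s)].
Proof.
move=> N0 r0 mE /andP[rho0 rho1] epsn tP cP.
have [P' tpP] := trig_poly_tp _ _ tP.
have s1 : (0 : R) < s%:R by rewrite ltr0n.
have r1 : (0 : R) < r%:R by rewrite ltr0n.
have N1 : (0 : R) < N%:R by rewrite ltr0n.
have mR : m%:R = 16 * s%:R * r%:R * N%:R :> R by rewrite mE !natrM.
have m1 : (0 : R) < m%:R by rewrite mR !mulr_gt0.
have pi4 : (pi : R) < 4 by have := @pihalf_lt2 R; lra.
have pi2 := @pi_ge2 R.
have rm0 : 0 < rho / m%:R by rewrite divr_gt0.
have tau_gt : 2 * (rho / m%:R) < 2 * pi / m%:R.
  by rewrite mulrA ltr_pM2r ?invr_gt0 // ltr_pM2l //; lra.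
pose q : R := (s%:R * r%:R)^-1.
have q0 : 0 < q by rewrite invr_gt0 mulr_gt0.
have Nm : N%:R / m%:R = q / 16 :> R.
  by rewrite mR /q; field; rewrite !gt_eqF.
have m_1 : m%:R^-1 <= q / 16 :> R.
  by rewrite -Nm -[X in X <= _]mul1r ler_pM2r ?invr_gt0 // ler1n.
have qs : q <= s%:R^-1.
  by rewrite /q invfM ler_piMr ?invr_ge0 ?ler0n // invf_le1 // ler1n.
have ps : pi / (2 * s%:R) = pi / 2 * s%:R^-1 :> R by field; rewrite gt_eqF.
have s_1 : 1 * s%:R^-1 <= pi / 2 * s%:R^-1 :> R.
  by rewrite ler_pM2r ?invr_gt0 //; lra.
have Ntau : N%:R * (2 * pi / m%:R) = 2 * pi * (q / 16).
  by rewrite -Nm; field; rewrite gt_eqF.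
have Ntau1 : N%:R * (2 * pi / m%:R) <= q / 2.
  have := ler_pM2r q0 pi 4; rewrite Ntau; lra.
have rm : rho / m%:R <= q / 16.
  by apply: le_trans m_1; rewrite ler_piMl // invr_ge0 ltW.
have sV : s%:R^-1 <= 1 :> R by rewrite invf_le1 // ler1n.
have psV : pi / 2 * s%:R^-1 <= pi / 2 :> R by rewrite ler_piMr //; lra.
have [||k [x [kN xk Px]]] := almost_comonotone_meets s N (eqd_node s) (eps n)
  (eqd_mid s) (rho / m%:R) (2 * pi / m%:R) P cP rm0 tau_gt epsn.
- rewrite /eqd_mid ps; lra.
- rewrite /eqd_mid ps; lra.
set t := x - eqd_mid s.
have xE : t + eqd_mid s = x by rewrite subrK.
have tk : `|t - k%:R * (2 * pi / m%:R)| <= rho / m%:R.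
  by congr (`|_| <= _): xk; rewrite /t; ring.
have tq : `|t| <= 9 / 16 * q.
  have tau0 : 0 <= 2 * pi / m%:R :> R by apply: ltW; apply: le_lt_trans tau_gt; lra.
  have k0 : 0 <= k%:R * (2 * pi / m%:R) :> R by apply: mulr_ge0.
  have kN' : k%:R * (2 * pi / m%:R) <= N%:R * (2 * pi / m%:R) :> R.
    by apply: ler_wpM2r => //; rewrite ler_nat ltnW.
  move: tk; rewrite ler_distl ler_norml; lra.
exists P', k, t; split=> //; first by rewrite mul1r -/q; lra.
have PiY0 : 0 < PiY s (eqd_node s) x.
  by apply: PiY_eqd_gt0 => //; rewrite -/t ps; lra.
rewrite xE; move: Px; rewrite pmulr_lge0 // derive1E.
by have := tp_derive _ _ _ x tpP => dP; rewrite derive_val.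
Qed.

End lower_bound.

(** * Adding one spike to a partial sum *)

Section spike_step.
Context {R : realType}.
Variables (s : nat) (eps : nat -> R).
Hypotheses (s_gt0 : (0 < s)%N)
  (eps_ge0 : forall n : nat, (0 < n)%N -> 0 <= eps n)
  (eps_cvg0 : eps n @[n --> \oo] --> (0 : R)).
Implicit Types (t x : R) (f F g P : R -> R).

Lemma sup_ge0 (E : set R) : (forall x, E x -> 0 <= x) -> 0 <= sup E.
Proof.
(* A set without a supremum has [sup] equal to 0. *)
move=> E0; have [supE|/sup_out->//] := pselect (has_sup E).
have [[x Ex] ubE] := supE.
by apply: le_trans (E0 x Ex) _; exact: ub_le_sup.
Qed.

Lemma omega4_ge0 f t : 0 <= omega4 f t.
Proof. by apply: sup_ge0 => _ [h _ <-]; apply: sup_ge0 => _ [x _ <-]. Qed.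

Lemma near_zero_bounds (r : nat) t : (0 < r)%N -> `|t| <= 1 / (s%:R * r%:R) ->
  [/\ 2^-1 <= cos (s%:R * t), `|t| <= r%:R^-1 & t ^+ 4 <= r%:R^-1].
Proof.
move=> r0 tsr.
have s1 : (1 : R) <= s%:R by rewrite ler1n.
have r1 : (1 : R) <= r%:R by rewrite ler1n.
have sV : s%:R^-1 <= 1 :> R by rewrite invf_le1 //; lra.
have rV : r%:R^-1 <= 1 :> R by rewrite invf_le1 //; lra.
have rV0 : 0 <= r%:R^-1 :> R by rewrite invr_ge0; lra.
have sV0 : 0 <= s%:R^-1 :> R by rewrite invr_ge0; lra.
rewrite mul1r invfM in tsr.
have tr : `|t| <= r%:R^-1 by apply: le_trans tsr _; rewrite ler_piMl.
split=> //.
  have st : `|s%:R * t| <= 1.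
    rewrite normrM normr_nat mulrC -ler_pdivlMr; last by lra.
    by apply: le_trans tsr _; rewrite mul1r ler_piMr.
  have := subr_cos_le (s%:R * t); rewrite -[(_ * t) ^+ 2]real_normK ?num_real //.
  have : `|s%:R * t| ^+ 2 <= 1 by rewrite exprn_ile1.
  lra.
rewrite -[t ^+ 4]ger0_norm ?exprn_even_ge0 // normrX exprS.
by apply: le_trans (tr); rewrite ler_piMr // exprn_ile1 // (le_trans tr).
Qed.

(** The induction step of the construction; [delta] is the room left for all later terms. The
    parameters are chosen in the order l (quality of the ratio), p = l^4 and eta, r (smallness of
    F'), N (smallness of [eps] and of the fourth differences of F), then m = 16 s r N and n = l^3 m.
    The constant K depends on s only. *)
Lemma add_spike : exists2 K : R, 0 < K & forall F (al : R) (l' : nat),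
  flat_comonotone s F -> 0 < al -> exists g n delta,
  [/\ spike_like s g, (l' <= n)%N, 0 < delta &
      forall f, (forall x, `|f x - (F x + al * g x)| <= delta) ->
      exists A, [/\ 0 < A, A <= E1 s (eqd_node s) n (fun x => f (x - eqd_mid s)) (eps n) &
        l'%:R * omega4 (fun x => f (x - eqd_mid s)) (pi / n%:R) <= K * A]].
Proof.
pose c1 : R := 2 * pi + 2 * pi ^+ 2 * s%:R.
have p2 := pi_ge2 R.
have pi4 : (pi : R) < 4 by have := @pihalf_lt2 R; lra.
have c1_gt0 : 0 < c1.
  by rewrite addr_gt0 ?mulr_gt0 ?exprn_gt0 ?ltr0n // pi_gt0.
(* In units of u = al eta/n, A is 3/32 and l omega_4 is at most 16 c1 + 1/4 (distance of f to H),
   plus 1 (from F), plus 768 (from T); 785 exceeds the sum of the numbers. *)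
exists ((16 * c1 + 785) * (32 / 3)); first by lra.
move=> F al l' [dF [F' [C [tpF Fs FC]]]] al0.
have [l0 l0_2 l0c] := exists_large (64 * c1) 2.
pose l := (l' + l0)%N.
have l2 : (2 <= l)%N by rewrite /l; lia.
have lc : 64 * c1 <= l%:R by apply: le_trans l0c _; rewrite ler_nat /l leq_addl.
have l'l : (l' <= l)%N by rewrite leq_addr.
clearbody l.
have l1 : (1 : R) <= l%:R by rewrite ler1n; lia.
have lR0 : (0 : R) < l%:R by lra.
pose p := (l ^ 4)%N.
have l_pow k : (0 < k)%N -> (2 <= l ^ k)%N.
  by move=> k0; apply: (leq_trans l2); rewrite -[leqLHS]expn1 leq_exp2l.
have p1 : (2 <= p)%N by exact: l_pow.
have pR0 : (0 : R) < p%:R by rewrite ltr0n ltnW.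
pose eta : R := 2 / p%:R ^+ 2.
have eta0 : 0 < eta by rewrite divr_gt0 // exprn_gt0.
have ae0 : 0 < al * eta by rewrite mulr_gt0.
(* This makes F' at most al eta/32 at the test points, where t^4 <= 1/r. *)
have [r r1 rC] := exists_large (512 * `|C| / (al * eta)) 1.
have rR0 : (0 : R) < r%:R by rewrite ltr0n.
have [C4 C40 FC4] := tp_diff4 _ _ _ tpF.
(* This makes the share of F in l omega_4 at most u; 256 = 4^4 bounds pi^4. *)
have [b1 b1l b1C] := exists_large (C4 * 256 * l%:R / (al * eta)) (s + dF + l').+1.
(* The threshold for [eps] is the total length N 2/(p m) of the test intervals, in which N
   cancels. *)
have e0 : 0 < 2 / (p%:R * (16 * s * r)%:R) :> R.
  by rewrite divr_gt0 // mulr_gt0 // ltr0n !muln_gt0 s_gt0.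
have [N Nb Neps] := eps_eventually_lt _ eps_cvg0 _ b1 e0.
pose m := (16 * s * r * N)%N.
have bN : (s + dF + l' < N)%N := leq_trans b1l Nb.
have N0 : (0 < N)%N := leq_ltn_trans (leq0n _) bN.
have Nm : (N <= m)%N by rewrite /m leq_pmull // !muln_gt0 s_gt0.
pose n := (l ^ 3 * m)%N.
have l3 : (2 <= l ^ 3)%N by exact: l_pow.
have mn : (2 * m <= n)%N by rewrite /n leq_mul2r l3 orbT.
have [m0 n0 sm msn [dn l'n bn]] : [/\ 0 < m, 0 < n, s < m, m + s <= n &
    [/\ dF <= n, l' <= n & N <= n]]%N.
  by move: bN Nm mn; clear; clearbody m n => *; split; [..|split]; lia.
have mR0 : (0 : R) < m%:R by rewrite ltr0n.
have nR0 : (0 : R) < n%:R by rewrite ltr0n.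
have := @spike R s m s_gt0 sm p p1; cbv zeta; rewrite -/eta -/c1.
move=> [dg [g [g' [T [T' [mu [Cg [[tpg tpT g0] [gs g2 gC] [mu0 mu1 T'E] gT T4]]]]]]]].
clearbody c1.
pose u := al * eta / n%:R.
have u0 : 0 < u by rewrite divr_gt0.
(* The gain: the distance of g to T is of order eta mu/m <= eta/(p m) = eta/(l n), a factor l below
   the lower bound of order eta/n. *)
have lpmn : p%:R * m%:R = l%:R * n%:R :> R.
  by rewrite -!natrM /p /n; congr (_%:R); rewrite mulnA -expnS.
have gT1 x : `|al * g x - al * T x| <= u * (c1 / l%:R).
  rewrite -mulrBr normrM gtr0_norm //.
  apply: (@le_trans _ _ (al * (eta * (c1 * p%:R^-1 / m%:R)))).
    rewrite ler_wpM2l ?(ltW al0) //; apply: le_trans (gT x) _.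
    rewrite ler_wpM2l ?(ltW eta0) // ler_wpM2r ?invr_ge0 ?(ltW mR0) //.
    by rewrite ler_wpM2l ?(ltW c1_gt0).
  rewrite -mulrA -invfM lpmn /u le_eqVlt; apply/orP; left; apply/eqP.
  by field; rewrite !gt_eqF.
have cl : c1 / l%:R <= 64^-1.
  by rewrite ler_pdivrMr // mulrC ler_pdivlMr //; lra.
have lV : l%:R^-1 <= 1 :> R by rewrite invf_le1.
have lV0 : 0 < l%:R^-1 :> R by rewrite invr_gt0.
exists g, n, (u * (l%:R^-1 / 64)); split.
- exact: tp_spike_like tpg g0 gs g2 gC.
- exact: l'n.
- by rewrite mulr_gt0 // divr_gt0.
move=> f fFg.
pose H x := F x + al * T x.
have fH x : `|f x - H x| <= u * ((1 / 64 + c1) / l%:R).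
  have -> : f x - H x = f x - (F x + al * g x) + (al * g x - al * T x).
    by rewrite /H; ring.
  apply: le_trans (ler_normD _ _) _; apply: le_trans (lerD (fFg x) (gT1 x)) _.
  by rewrite le_eqVlt; apply/orP; left; apply/eqP; field; rewrite gt_eqF.
have tpH : tp n H (fun x => F' x + al * T' x).
  apply: tpD (tpZ _ _ _ _ (tp_le _ _ _ _ msn tpT)).
  exact: tp_le dn tpF.
pose b := al * eta / 4.
have fHb x : `|f x - H x| <= b / (8 * n%:R).
  apply: le_trans (fH x) _.
  have -> : b / (8 * n%:R) = u * 32^-1 by rewrite /b /u; field; rewrite gt_eqF.
  rewrite ler_pM2l // mulrDl; lra.
exists (3 * b / (8 * n%:R)); split.
- by rewrite divr_gt0 // mulr_gt0 // /b; lra.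
- apply: E1_ge => [|P tP cP]; first exact: eps_ge0.
  have rho01 : 0 < (p%:R^-1 : R) <= 1.
    by rewrite invr_gt0 pR0 /= invf_le1 // ler1n ltnW.
  have epsn : eps n < N%:R * (2 * (p%:R^-1 / m%:R)).
    have -> : N%:R * (2 * (p%:R^-1 / m%:R)) = 2 / (p%:R * (16 * s * r)%:R) :> R.
      rewrite /m (natrM _ _ N).
      by field; rewrite !gt_eqF // ltr0n.
    exact: Neps bn.
  have [P' [k [t [tpP tk tsr P't]]]] :=
    comonotone_nonneg_slope s eps s_gt0 N m n r _ P N0 r1 erefl rho01 epsn tP cP.
  pose w : R := - eqd_mid s.
  have tpHw := tp_shift _ w _ _ tpH.
  have [MH HM] := tp_bounded _ _ _ tpH.
  have fM x : `|f (x + w)| <= b / (8 * n%:R) + MH.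
    rewrite -[f _](subrK (H (x + w))); apply: le_trans (ler_normD _ _) _.
    by rewrite lerD.
  apply: (sup_norm_bernstein n _ _ _ _ _ b _ (t + eqd_mid s) _ tpP tpHw fM) => [|x|].
  + exact: n0.
  + exact: fHb.
  rewrite addrK T'E.
  have [cst tr t4] := near_zero_bounds _ _ r1 tsr.
  have F't : F' t <= al * eta / 32.
    apply: le_trans (ler_norm _) (le_trans (FC t) _).
    apply: (@le_trans _ _ (`|C| * r%:R^-1)).
      apply: (@le_trans _ _ (`|C| * t ^+ 4)).
        by rewrite ler_wpM2r ?exprn_even_ge0 // ler_norm.
      by rewrite ler_wpM2l.
    rewrite ler_pdivrMr //; move: rC; rewrite ler_pdivrMr //.
    by have := normr_ge0 C; lra.
  have mu01 : 0 <= mu <= (l ^ 4)%:R^-1 by rewrite mu0.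
  (* With P' >= 0, F' <= al eta/32 and al T' <= -(11/32) al eta, the slope difference is at least
     (10/32) al eta >= b. *)
  have := spike_slope s l m k mu eta t l2 m0 mu01 cst tk erefl.
  by move=> /(ler_wpM2l (ltW al0)); rewrite /b; lra.
- have pn0 : 0 < pi / n%:R :> R by rewrite divr_gt0 // pi_gt0.
  have am0 : 0 <= al * (6 * m%:R ^+ 3).
    by rewrite mulr_ge0 ?(ltW al0) // mulr_ge0 // exprn_ge0 // ltW.
  have C60 : 0 <= C4 + al * (6 * m%:R ^+ 3).
    by rewrite addr_ge0.
  have Hd h x : `|diff4 h (fun x => H (x - eqd_mid s)) x| <=
      (C4 + al * (6 * m%:R ^+ 3)) * h ^+ 4.
    rewrite diff4_shift diff4D diff4Z mulrDl; apply: le_trans (ler_normD _ _) _.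
    rewrite lerD // normrM gtr0_norm // -mulrA ler_wpM2l ?(ltW al0) //.
  have := omega4_perturb (fun x => f (x - eqd_mid s)) (fun x => H (x - eqd_mid s))
    _ _ _ pn0 C60 (fun x => fH _) Hd.
  move=> /(ler_wpM2l (ltW lR0)) => om.
  have om0 : l'%:R * omega4 (fun x => f (x - eqd_mid s)) (pi / n%:R) <=
     l%:R * omega4 (fun x => f (x - eqd_mid s)) (pi / n%:R).
    by rewrite ler_wpM2r ?omega4_ge0 // ler_nat.
  apply: le_trans om0 (le_trans om _).
  have pn4 : (pi / n%:R) ^+ 4 <= 256 / n%:R ^+ 4 :> R.
    rewrite expr_div_n ler_pM2r ?invr_gt0 ?exprn_gt0 //.
    have -> : 256 = 4 ^+ 4 :> R by ring.
    by rewrite lerXn2r ?nnegrE ?pi_ge0 // ltW.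
  have n1 : (1 : R) <= n%:R by rewrite ler1n.
  have x1 : l%:R * (C4 * (pi / n%:R) ^+ 4) <= u.
    apply: (@le_trans _ _ (l%:R * (C4 * (256 / n%:R ^+ 4)))).
      by rewrite ler_wpM2l ?(ltW lR0) // ler_wpM2l.
    have -> : l%:R * (C4 * (256 / n%:R ^+ 4)) = C4 * 256 * l%:R / n%:R ^+ 3 / n%:R.
      by field; rewrite gt_eqF.
    rewrite ler_pM2r ?invr_gt0 // ler_pdivrMr ?exprn_gt0 // [leRHS]mulrC -ler_pdivrMr //.
    apply: le_trans b1C _; apply: (@le_trans _ _ n%:R).
      by rewrite ler_nat (leq_trans Nb bn).
    by rewrite -{1}(expr1 n%:R) ler_weXn2l.
  have x2 : l%:R * (al * (6 * m%:R ^+ 3) * (pi / n%:R) ^+ 4) <= 768 * u.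
    apply: (@le_trans _ _ (l%:R * (al * (6 * m%:R ^+ 3) * (256 / n%:R ^+ 4)))).
      by apply: ler_wpM2l; [exact: ltW|apply: ler_wpM2l].
    rewrite /u /eta /n /p natrM !natrX le_eqVlt; apply/orP; left; apply/eqP.
    by field; rewrite !gt_eqF.
  have x3 : l%:R * (16 * (u * ((1 / 64 + c1) / l%:R))) = (1 / 4 + 16 * c1) * u.
    by field; rewrite gt_eqF.
  rewrite mulrDr x3 (mulrDl C4) mulrDr.
  have -> : (16 * c1 + 785) * (32 / 3) * (3 * b / (8 * n%:R)) = (16 * c1 + 785) * u.
    by rewrite /u /b; field; rewrite gt_eqF.
  lra.
Qed.

End spike_step.

(** * Sums and uniform limits of comonotone functions *)

Section summation.
Context {R : realType}.
Variable s : nat.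
Hypothesis s_gt0 : (0 < s)%N.
Implicit Types (t x : R) (f F g : R -> R).

Lemma cosD2piz x (k : int) : cos (x + k%:~R * (2 * pi)) = cos x.
Proof.
case: k => n; first exact: cosD2pin.
by rewrite NegzE mulrNz mulNr -[in RHS](subrK (n.+1%:R * (2 * pi)) x) cosD2pin.
Qed.

Lemma flat_comonotone0 : flat_comonotone s (fun=> 0 : R).
Proof.
exists 0%N, (fun=> 0), 0; split=> [|t|t]; first exact: tp0.
  by rewrite mul0r.
by rewrite normr0 mul0r.
Qed.

Lemma flat_comonotoneD F g (al : R) : 0 <= al ->
  flat_comonotone s F -> flat_comonotone s g ->
  flat_comonotone s (fun x => F x + al * g x).
Proof.
move=> al0 [d [F' [C [tF Fs FC]]]] [e [g' [D [tg gs gD]]]].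
exists (d + e)%N, (fun x => F' x + al * g' x), (C + al * D); split=> [|t|t].
- exact: tpD (tp_le _ _ _ _ (leq_addr _ _) tF)
    (tpZ _ _ _ _ (tp_le _ _ _ _ (leq_addl _ _) tg)).
- by rewrite mulrDl -mulrA addr_ge0 // mulr_ge0.
- apply: le_trans (ler_normD _ _) _; rewrite mulrDl lerD // normrM ger0_norm //.
  by rewrite -mulrA ler_wpM2l.
Qed.

(** The strictly interior c matters: if u and v lie between consecutive zeros of cos(st), then
    cos(sc) is nonzero and the sign of F v - F u can be read off. *)
Lemma flat_comonotone_mvt F (u v : R) : flat_comonotone s F -> u < v ->
  exists2 c, u < c < v & 0 <= (F v - F u) * cos (s%:R * c).
Proof.
move=> [d [F' [C [tF Fs FC]]]] uv.
have [|c] := MVT uv (fun x _ => tp_derive d F F' x tF).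
  apply: continuous_subspaceT => x; apply: differentiable_continuous.
  by apply/derivable1_diffP; have := tp_derive d F F' x tF; case.
rewrite in_itv /= => cuv ->; exists c => //.
by rewrite mulrAC mulr_ge0 // subr_ge0 ltW.
Qed.

Lemma eqd_node_is_Ys : is_Ys s (@eqd_node R s).
Proof.
have s0 : (0 : R) < s%:R by rewrite ltr0n.
have p0 := pi_gt0 R; have q0 : 0 < pi / s%:R :> R by rewrite divr_gt0.
split.
- rewrite /eqd_node -pmulrn natrM le_eqVlt; apply/orP; left; apply/eqP.
  by field; rewrite gt_eqF.
- move=> i _ _; rewrite /eqd_node rmorphD /= mulrDl; lra.
- rewrite /eqd_node; lra.
- move=> i; rewrite /eqd_node rmorphD /= -pmulrn natrM.
  by field; rewrite gt_eqF.
Qed.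

(** The period and the signs of increments survive uniform limits; continuity comes from the
    Lipschitz bound. *)
Lemma approx_flat_Delta1 f (L : R) : (forall a b, `|f b - f a| <= L * `|b - a|) ->
  (forall e, 0 < e -> exists2 F, flat_comonotone s F & forall x, `|f x - F x| <= e) ->
  Delta1 (eqd_node s) (fun x => f (x - eqd_mid s)).
Proof.
move=> fL fF.
have s0 : (0 : R) < s%:R by rewrite ltr0n.
have half (e : R) : 0 < e -> 0 < e / 2 by move=> e0; rewrite divr_gt0.
have L0 : 0 <= L.
  by have := fL 0 1; rewrite subr0 normr1 mulr1; apply: le_trans.
(* The phase [b%:R * pi] covers both cases at once: cos(sc) is positive for [b = false] and negative
   for [b = true]. *)
have mono (u v : R) (k : int) (b : bool) : u <= v ->
    (forall c, u < c < v ->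
       - (pi / 2) < s%:R * c + (b%:R * pi + k%:~R * (2 * pi)) < pi / 2) ->
    0 <= (-1) ^+ b * (f v - f u).
  rewrite le_eqVlt => /predU1P[->|uv] H; first by rewrite subrr mulr0.
  apply/ler_addgt0Pr => e e0.
  have [F Fc Fe] := fF _ (half e e0).
  have [c cuv] := flat_comonotone_mvt _ _ _ Fc uv.
  have := cos_gt0_pihalf (H c cuv); rewrite addrA cosD2piz.
  have := Fe u; have := Fe v; rewrite !ler_norml.
  case: b {H}; rewrite ?expr1 ?expr0 ?mul1r ?mul0r ?addr0 ?cosDpi => h1 h2 h3 h4.
    have : F v - F u <= 0.
      rewrite leNgt; apply: contraTN h4 => h5.
      by rewrite -ltNge pmulr_rlt0 //; lra.
    by lra.
  rewrite pmulr_lge0 // in h4; lra.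
have nodeE (k : int) : (eqd_node s k : R) = eqd_mid s + (pi / 2 - k%:~R * pi) / s%:R.
  by rewrite /eqd_node /eqd_mid; field; rewrite gt_eqF.
split.
- move=> x; apply/cvgrPdist_lt => e e0; near=> y.
  apply: le_lt_trans (fL _ _) _.
  have -> : x - eqd_mid s - (y - eqd_mid s) = x - y by ring.
  apply: (@le_lt_trans _ _ ((L + 1) * `|x - y|)).
    by rewrite ler_wpM2r //; lra.
  rewrite mulrC -ltr_pdivlMr; last by lra.
  near: y; apply/nbhs_ballP; exists (e / (L + 1)) => //=.
  by rewrite divr_gt0 //; lra.
- move=> x; apply/eqP; rewrite -subr_eq0 -normr_le0; apply/ler_addgt0Pr => e e0.
  have [F [d [F' [C [tF _ _]]]] Fe] := fF _ (half e e0).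
  have -> : x + 2 * pi - eqd_mid s = x - eqd_mid s + 2 * pi by ring.
  have := Fe (x - eqd_mid s + 2 * pi); have := Fe (x - eqd_mid s).
  by rewrite (tp_periodic _ _ _ _ tF) !ler_norml; lra.
- move=> k u v; rewrite !in_itv /= => /andP[u1 u2] /andP[v1 v2] uv.
  have := mono (u - eqd_mid s) (v - eqd_mid s) k false.
  rewrite expr0 mul1r subr_ge0; apply; first by rewrite lerD2r.
  move=> c /andP[c1 c2].
  have c3 : (pi / 2 - (2 * k + 1)%:~R * pi) / s%:R < c by rewrite (le_lt_trans _ c1) // lerBrDl -nodeE.
  have c4 : c < (pi / 2 - (2 * k)%:~R * pi) / s%:R by rewrite (lt_le_trans c2) // lerBlDl -nodeE.
  move: c3 c4; rewrite ltr_pdivrMr // ltr_pdivlMr // (mulrC c) !rmorphD rmorphM /=.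
  lra.
- move=> k u v; rewrite !in_itv /= => /andP[u1 u2] /andP[v1 v2] vu.
  have := mono (v - eqd_mid s) (u - eqd_mid s) k true.
  rewrite expr1 mulN1r oppr_ge0 subr_le0; apply; first by rewrite lerD2r.
  move=> c /andP[c1 c2].
  have c3 : (pi / 2 - (2 * k + 2)%:~R * pi) / s%:R < c by rewrite (le_lt_trans _ c1) // lerBrDl -nodeE.
  have c4 : c < (pi / 2 - (2 * k + 1)%:~R * pi) / s%:R by rewrite (lt_le_trans c2) // lerBlDl -nodeE.
  move: c3 c4; rewrite ltr_pdivrMr // ltr_pdivlMr // (mulrC c) !rmorphD rmorphM /=.
  lra.
Unshelve. all: by end_near.
Qed.

End summation.

(** * Limit of the partial sums *)

Section limits.
Context {R : realType}.
Implicit Types (f : R -> R) (F : nat -> R -> R) (al : nat -> R).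

Lemma geometric_limit F al (c : R) : 0 <= c -> (forall k, 0 < al k) ->
  (forall k, al k.+1 <= al k / 2) ->
  (forall k x, `|F k.+1 x - F k x| <= c * al k) ->
  exists f, forall k x, `|f x - F k x| <= 2 * c * al k.
Proof.
move=> c0 al0 al2 Fc.
have tail k j x : `|F (k + j)%N x - F k x| <= 2 * c * al k - 2 * c * al (k + j)%N.
  elim: j => [|j IH]; first by rewrite addn0 !subrr normr0.
  rewrite addnS -(subrKA (F (k + j)%N x)); apply: le_trans (ler_normD _ _) _.
  have := Fc (k + j)%N x; have := ler_wpM2l c0 (al2 (k + j)%N); lra.
have cross j k x : F j x - 2 * c * al j <= F k x + 2 * c * al k.
  have ac i : 0 <= 2 * c * al i by rewrite !mulr_ge0 // ltW.
  have [jk|kj] := leqP j k.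
    have := tail j (k - j)%N x; rewrite subnKC // ler_norml.
    by have := ac k; have := ac j; lra.
  have := tail k (j - k)%N x; rewrite subnKC ?(ltnW kj) // ler_norml.
  by have := ac k; have := ac j; lra.
exists (fun x => sup [set F j x - 2 * c * al j | j in setT]) => k x.
have up : sup [set F j x - 2 * c * al j | j in setT] <= F k x + 2 * c * al k.
  by apply: ge_sup => [|_ [j _ <-]]; [eexists; exists 0%N|exact: cross].
have lo : F k x - 2 * c * al k <= sup [set F j x - 2 * c * al j | j in setT].
  apply: ub_le_sup; last by exists k.
  by exists (F 0%N x + 2 * c * al 0%N) => _ [j _ <-]; exact: cross.
by rewrite ler_norml; lra.
Qed.

(** A constant function is its own admissible approximant, with error 0. *)
Lemma E1_gt0_nonconstant (s n : nat) (y : int -> R) f (e : R) : 0 <= e ->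
  0 < E1 s y n f e -> exists x z, f x != f z.
Proof.
move=> e0 E0; apply: contrapT => H; move: E0; apply/negP; rewrite -leNgt.
have fE x : f x = f 0 by apply: contrapT => /eqP fx; apply: H; exists x, 0.
have := @ge_inf R [set sup_norm (f \- P) | P in trig_poly n `&` almost_comonotone s y e].
move=> /(_ _ (sup_norm (f \- (fun=> f 0)))) h.
apply: le_trans (h _ _) _.
- by exists 0 => _ [P _ <-]; apply: sup_ge0 => _ [x _ <-].
- by exists (fun=> f 0) => //; split; [exact: trig_poly_cst|exact: almost_comonotone_cst].
apply: ge_sup => [|_ [x _ <-]]; first by exists `|(f \- (fun=> f 0)) 0|, 0.
by rewrite /= fE subrr normr0.
Qed.

End limits.

(** * Recursive construction of the function and conclusion *)

Theorem theorem1 (R : realType) (s : nat) (hs : (0 < s)%N) (eps : nat -> R)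
    (eps_ge0 : forall n : nat, (0 < n)%N -> 0 <= eps n)
    (eps_cvg0 : eps n @[n --> \oo] --> (0 : R)) :
  exists (y : int -> R) (f : R -> R),
    [/\ is_Ys s y, Delta1 y f &
      limn_esup (fun n => (E1 s y n f (eps n) / omega4 f (pi / n%:R))%:E)
        = +oo%E].
Proof.
have pi0 := pi_gt0 R.
have [K K0 spikes] := add_spike s eps hs eps_ge0 eps_cvg0.
pose ok (F : R -> R) (al : R) (k : nat) (o : (R -> R) * nat * R) :=
  let: (g, n, delta) := o in
  [/\ spike_like s g, (k.+1 <= n)%N, 0 < delta &
    forall f, (forall x, `|f x - (F x + al * g x)| <= delta) ->
    exists A, [/\ 0 < A, A <= E1 s (eqd_node s) n (fun x => f (x - eqd_mid s)) (eps n) &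
      k.+1%:R * omega4 (fun x => f (x - eqd_mid s)) (pi / n%:R) <= K * A]].
have nexts (st : (R -> R) * R * nat) : exists o, flat_comonotone s st.1.1 ->
    0 < st.1.2 -> ok st.1.1 st.1.2 st.2 o.
  case: st => -[F al] k /=.
  have [[Fc al0]|H] := pselect (flat_comonotone s F /\ 0 < al); last first.
    (* An arbitrary value outside the invariant, so that [choice] yields a total function. *)
    by exists (F, 0%N, al) => Fc al0; case: H.
  by have [g [n [delta H]]] := spikes F al k.+1 Fc al0; exists (g, n, delta).
have [next nextP] := choice nexts.
(* Halving al gives geometric convergence; the bound delta/(4 pi) keeps the whole tail, at most 4 pi
   al_(k+1), within the room left at step k. *)
pose upd k (st : (R -> R) * R) :=
  let: (g, _, delta) := next (st, k) in
  (fun x => st.1 x + st.2 * g x, Num.min (st.2 / 2) (delta / (4 * pi))).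
pose st k := iteri k upd (fun=> 0, 1).
pose F k := (st k).1; pose al k := (st k).2.
pose g k := (next (st k, k)).1.1; pose n k := (next (st k, k)).1.2.
pose delta k := (next (st k, k)).2.
have FS k x : F k.+1 x = F k x + al k * g k x.
  by rewrite /F /al /g /st /= {1}/upd; case: (next _) => -[].
have alS k : al k.+1 = Num.min (al k / 2) (delta k / (4 * pi)).
  by rewrite /al /delta /st /= {1}/upd; case: (next _) => -[].
have okP k : flat_comonotone s (F k) -> 0 < al k -> ok (F k) (al k) k (g k, n k, delta k).
  move=> Fc al0; have := nextP (st k, k) Fc al0.
  by rewrite /g /n /delta; case: (next _) => -[].
have inv k : flat_comonotone s (F k) /\ 0 < al k.
  elim: k => [|k [Fc al0]]; first by split; [exact: flat_comonotone0|exact: ltr01].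
  have [[gc _ _] _ d0 _] := okP k Fc al0; split.
    have -> : F k.+1 = fun x => F k x + al k * g k x by apply/funext => x.
    by apply: flat_comonotoneD => //; exact: ltW.
  by rewrite alS lt_min !divr_gt0 // mulr_gt0.
have Fc k : flat_comonotone s (F k) by case: (inv k).
have al0 k : 0 < al k by case: (inv k).
have {}okP k := okP k (Fc k) (al0 k).
have al2 k : al k.+1 <= al k / 2 by rewrite alS ge_min lexx.
have al_delta k : 4 * pi * al k.+1 <= delta k.
  rewrite mulrC -ler_pdivlMr ?mulr_gt0 //.
  by rewrite alS ge_min lexx orbT.
have al_le k : al k <= k.+1%:R^-1.
  elim: k => [|k IH]; first by rewrite invr1.
  apply: le_trans (al2 k) _; rewrite -[leRHS]mul1r ler_pdivlMr // mulrAC ler_pdivrMr //.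
  apply: le_trans (ler_wpM2r _ IH) _; first by [].
  by rewrite mul1r mulrC ler_pdivrMr // -natrM ler_nat; lia.
have [f fF] : exists f, forall k x, `|f x - F k x| <= 2 * (2 * pi) * al k.
  apply: (geometric_limit _ _ _ _ al0 al2); first by rewrite mulr_ge0 // ltW.
  move=> k x; rewrite FS (addrC (F k x)) addrK normrM gtr0_norm // [leRHS]mulrC.
  by have [[_ _ gb] _ _ _] := okP k; rewrite ler_wpM2l // ltW.
have fFe e : 0 < e -> exists2 k, flat_comonotone s (F k) &
    forall x, `|f x - F k x| <= e.
  move=> e0; have [k _ kP] := exists_large (2 * (2 * pi) / e) 0.
  exists k => // x; apply: le_trans (fF k x) _.
  apply: le_trans (ler_wpM2l _ (al_le k)) _; first by rewrite !mulr_ge0 // ltW.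
  rewrite ler_pdivrMr // [leRHS]mulrC -ler_pdivrMr //; apply: le_trans kP _.
  by rewrite ler_nat.
(* The term -4 al_k makes the induction work: 4 - 4 al_k + 2 al_k <= 4 - 4 al_(k+1). *)
have FL k a b : `|F k b - F k a| <= (4 - 4 * al k) * `|b - a|.
  elim: k => [|k IH]; first by rewrite /F /al /= subrr normr0 mulr1 subrr mul0r.
  have [[_ gL _] _ _ _] := okP k.
  have -> : F k.+1 b - F k.+1 a = (F k b - F k a) + al k * (g k b - g k a).
    by rewrite !FS; ring.
  apply: le_trans (ler_normD _ _) _.
  have -> : `|al k * (g k b - g k a)| = al k * `|g k b - g k a|.
    by rewrite normrM gtr0_norm.
  have := ler_wpM2l (ltW (al0 k)) (gL a b).
  have := ler_wpM2r (normr_ge0 (b - a)) (al2 k); lra.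
have fL a b : `|f b - f a| <= 4 * `|b - a|.
  apply/ler_addgt0Pr => e e0.
  have [k _ kP] := fFe (e / 2) (divr_gt0 e0 (ltr0n _ 2)).
  have -> : f b - f a = (f b - F k b) - (f a - F k a) + (F k b - F k a) by ring.
  apply: le_trans (ler_normD _ _) _; apply: le_trans (lerD (ler_normB _ _) (FL k a b)) _.
  have : 0 <= al k * `|b - a| by rewrite mulr_ge0 // ltW.
  by have := kP a; have := kP b; rewrite mulrBl; lra.
have fD : Delta1 (eqd_node s) (fun x => f (x - eqd_mid s)).
  apply: (approx_flat_Delta1 _ hs _ 4) => // e /fFe[k kF kfe].
  by exists (F k).
exists (eqd_node s), (fun x => f (x - eqd_mid s)); split=> //.
  exact: eqd_node_is_Ys.
apply: limn_esup_pinfty => B N.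
(* The quotient at n_k is at least (k+1)/K, hence at least B. *)
have [k Nk Bk] := exists_large (B * K) N.
have [_ kn _ kP] := okP k.
have [|A [A0 AE Ao]] := kP f.
  move=> x; have -> : F k x + al k * g k x = F k.+1 x by rewrite FS.
  by apply: le_trans (fF k.+1 x) _; rewrite mulrA -natrM; exact: al_delta.
exists (n k); first by rewrite (leq_trans Nk) // ltnW.
have n0 : (0 < n k)%N := leq_ltn_trans (leq0n _) kn.
have [x [z fxz]] := E1_gt0_nonconstant _ _ _ _ _ (eps_ge0 _ n0) (lt_le_trans A0 AE).
have [_ fp _ _] := fD.
have o0 : 0 < omega4 (fun x => f (x - eqd_mid s)) (pi / (n k)%:R).
  apply: (omega4_gt0 _ _ (2 * (2 * pi)) _ _ _ _ fp fxz).
    by rewrite divr_gt0 // ltr0n.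
  (* As F_0 = 0 and al_0 = 1, the error bound at k = 0 bounds f itself. *)
  move=> w; have := fF 0%N (w - eqd_mid s).
  by rewrite /F /al /= subr0 mulr1.
rewrite ler_pdivlMr //; apply: le_trans AE.
rewrite -(ler_pM2l K0); apply: le_trans Ao.
rewrite mulrA ler_pM2r // mulrC; apply: le_trans Bk _.
by rewrite ler_nat.
Qed.
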